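(* There is a widely-connected subspace $\widetilde W$ of $\mathbb{R}^3$ with more than one point such that every compactification $\gamma\widetilde W$ of $\widetilde W$ is reducible between every two points of $\widetilde W$.
   Context: A connected topological space $W$ is widely-connected if every non-degenerate connected subset of $W$ (one with more than one point) is dense in $W$. A compactification of $W$ is a compact Hausdorff space (not necessarily metrizable) in which $W$ is densely embedded; $W$ is identified with its image. A connected space $Y$ is reducible between two points $p,q\in Y$ if there is a closed connected $C\subsetneq Y$ with $\{p,q\}\subseteq C$. *)

(* Defs.v *)
From HB Require Import structures.
From mathcomp Require Import all_boot all_order all_algebra.
From mathcomp Require Import all_classical all_reals all_analysis.
Import Order.TTheory GRing.Theory Num.Theory.
Import numFieldNormedType.Exports.

Set Implicit Arguments.
Unset Strict Implicit.
Unset Printing Implicit Defensive.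

Local Open Scope classical_set_scope.

Definition more_than_one_point (T : Type) (A : set T) : Prop :=
  exists x y : T, [/\ A x, A y & x <> y].

Definition widely_connected (W : topologicalType) : Prop :=
  connected [set: W] /\
  forall C : set W, connected C -> more_than_one_point C -> dense C.

(* The last conjunct says that [e] is open onto its image, so that [e] is a
   homeomorphism from [X] onto the subspace [range e] of [Y]. *)
Definition topological_embedding (X Y : topologicalType) (e : X -> Y) : Prop :=
  [/\ injective e, continuous e &
      forall U : set X, open U ->
        exists2 V : set Y, open V & e @` U = V `&` range e].

Definition compactification (W K : topologicalType) (e : W -> K) : Prop :=
  [/\ compact [set: K], hausdorff_space K,
      topological_embedding e & dense (range e)].

(* Reducibility is only a notion for connected spaces, hence the first
   conjunct. *)
Definition reducible_between (Y : topologicalType) (p q : Y) : Prop :=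
  connected [set: Y] /\
  exists C : set Y, [/\ closed C, connected C, C `<` [set: Y] & [set p; q] `<=` C].

(* Main.v *)
Require Import Defs.
From HB Require Import structures.
From mathcomp Require Import all_boot all_order all_algebra.
From mathcomp Require Import all_classical all_reals all_analysis.
From mathcomp Require Import ring lra zify.
Import Order.TTheory GRing.Theory Num.Theory.
Import numFieldNormedType.Exports.
Local Open Scope classical_set_scope.

Set Implicit Arguments.
Unset Strict Implicit.
Unset Printing Implicit Defensive.

(** Two properties of a space carry the theorem.

    - Linking: any two points p, q lie in a proper closed subset G that is not
      the union of two disjoint closed sets, one containing p and the other q
      (lemma wpoints_linked).
    - Every connected subset that misses a nonempty open set has at most one
      point (lemma nondense_connected_degenerate).

    Linking makes the space connected.  It also passes to every compactification
    K: the closure of G in K is a proper closed subset, in which p and q are not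
    separated by disjoint closed sets, and in a compact Hausdorff space a
    quasi-component is connected (lemma quasi_component).  So p and q lie in a
    proper subcontinuum of K.

    The space has as its skeleton a bipartite graph, whose edges are the nonzero
    0-1 sequences c.  The X-end of c is c without its digit 0, and the Y-end of c
    is c without the digit that follows its first 1, so that a vertex belongs to
    at most two edges.  Crossing X- and Y-vertices in turn
    changes the initial word of the sequence as the reflected Gray code does:
    the words of length n form a path, and this is the combinatorics of the
    bucket-handle continuum.  X-vertices are coded by reals on one line of
    space, Y-vertices by reals on a skew line, and an edge is the segment
    between its ends (definition pt): such segments meet only in common ends.

    On this graph two changes are made.  Let the mass of c be the sum of
    c_i / (i + 1).  Only sequences of finite mass are kept, and in the interior
    of the edge c at most one point is kept, at the height s for which mass c - s
    is an integer.  Adding remote digits raises the mass by steps as small as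
    desired, without bound; as in the rational Hilbert space of Erdos, no clopen
    set can therefore separate the two ends of an edge (lemma walk), although
    each edge carries at most three points.  Secondly, let j be the position of
    the first 1 of c.  If all partial sums of the mass over the digits from j + 2
    on are smaller than j + 1, then the Y-end of c is dead: the interior point of
    c is removed, and all dead Y-ends with the same j are collapsed to one point
    z_j.

    Every sequence of finite mass is dead for all large j, when its initial word
    is replaced by one whose first 1 is at j.  It is nevertheless a limit of
    sequences that are not dead there; the Gray path of such a sequence runs from
    near any vertex of the given strand to a point near z_j.  Hence all points
    are linked to z_j, inside the complement of a neighbourhood of z_(j+1).

    Conversely, let A be connected and miss an open set.  Then A misses an open
    piece of all edges with some initial word of length n.  This cuts the path of
    words of length n into two halves, and each half ends at a single Y-vertex of
    level at least n - 1.  The digits beyond that level, as far as a finite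
    partial sum certifies that the vertex is not dead, are locally constant on A
    (definition visible_tail).  If they become visible, A is contained in a
    finite set.  Otherwise every strand that A meets is dead at the end of its
    half-path; then A avoids all Y-vertices of level at least n - 1, because they
    are isolated points of A, and the same argument applies to the levels below,
    one after another (lemma no_high_Y_degenerate). *)

Local Open Scope ring_scope.

(** Arithmetic on natural numbers in a context of real inequalities: only the
    hypotheses that can matter are kept. *)
Ltac nlia :=
  repeat match goal with
  | H : is_true (leq _ _) |- _ => revert H
  | H : @eq nat _ _ |- _ => revert H
  end; clear; intros; lia.

(** * Weighted sums of 0-1 sequences, and codes of sequences by reals *)

Definition agree (N : nat) (c d : nat -> bool) : Prop :=
  forall i, (i < N)%N -> c i = d i.

Section WeightedSums.
Variable R : realType.
Implicit Types (w : nat -> R) (c d : nat -> bool).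

Definition wsum w c (m N : nat) : R :=
  \sum_(m <= i < N) (if c i then w i else 0).

Definition wbounded w c : Prop := exists B, forall N, wsum w c 0 N <= B.

(** Meaningful only when the sums are bounded; it is then their limit. *)
Definition wlim w c : R := sup (range (wsum w c 0)).

Lemma eq_wsum w c d m N :
  (forall i, (m <= i < N)%N -> c i = d i) -> wsum w c m N = wsum w d m N.
Proof. by move=> cd; apply: eq_big_nat => i /cd ->. Qed.

Lemma wsum_recr w c m N : (m <= N)%N ->
  wsum w c m N.+1 = wsum w c m N + (if c N then w N else 0).
Proof. by move=> mN; rewrite /wsum big_nat_recr. Qed.

Lemma wsum_cat w c m n p : (m <= n)%N -> (n <= p)%N ->
  wsum w c m p = wsum w c m n + wsum w c n p.
Proof. by move=> mn np; rewrite /wsum (big_cat_nat mn np). Qed.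

Lemma wsum_geq w c m N : (N <= m)%N -> wsum w c m N = 0.
Proof. by move=> Nm; rewrite /wsum big_geq. Qed.

Lemma wsum_eq0 w c m N :
  (forall i, (m <= i < N)%N -> c i = false) -> wsum w c m N = 0.
Proof.
by move=> c0; rewrite /wsum big_nat big1 // => i /c0 ->.
Qed.

Section Nonneg.
Variable w : nat -> R.
Hypothesis w_ge0 : forall i, 0 <= w i.

Lemma wsum_ge0 c m N : 0 <= wsum w c m N.
Proof. by apply: sumr_ge0 => i _; case: (c i). Qed.

Lemma wsum_le_all c m N : wsum w c m N <= \sum_(m <= i < N) w i.
Proof. by apply: ler_sum => i _; case: (c i). Qed.

Lemma wsum_homor c m N M : (N <= M)%N -> wsum w c m N <= wsum w c m M.
Proof.
move=> NM; have [mN|/ltnW Nm] := leqP m N; last first.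
  by rewrite wsum_geq //; exact: wsum_ge0.
by rewrite (@wsum_cat w c m N M) // lerDl wsum_ge0.
Qed.

Lemma wsum_homol c m n N : (m <= n)%N -> wsum w c n N <= wsum w c m N.
Proof.
move=> mn; have [nN|/ltnW Nn] := leqP n N; last first.
  by rewrite wsum_geq //; exact: wsum_ge0.
by rewrite (@wsum_cat w c m n N) // lerDr wsum_ge0.
Qed.

Lemma wlim_ub c N : wbounded w c -> wsum w c 0 N <= wlim w c.
Proof.
move=> [B cB]; apply: ub_le_sup; last by exists N.
by exists B => _ [M _ <-].
Qed.

Lemma wlim_le c B : (forall N, wsum w c 0 N <= B) -> wlim w c <= B.
Proof.
move=> cB; apply: ge_sup; first by exists (wsum w c 0 0); exists 0%N.
by move=> _ [M _ <-].
Qed.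

Lemma wlim_adherent c e : wbounded w c -> 0 < e ->
  exists N, wlim w c - e < wsum w c 0 N.
Proof.
move=> [B cB] e0.
have [|_ [N _ <-] ?] := @sup_adherent R (range (wsum w c 0)) e e0.
  by split; [exists (wsum w c 0 0); exists 0%N | exists B => _ [M _ <-]].
by exists N.
Qed.

Lemma wsum_finite c N M : (forall i, (N <= i)%N -> c i = false) ->
  wsum w c 0 M <= wsum w c 0 N.
Proof.
move=> c0; have [MN|/ltnW NM] := leqP M N; first exact: wsum_homor.
rewrite (@wsum_cat w c 0 N M) // (@wsum_eq0 w c N M) ?addr0 //.
by move=> i /andP[? _]; exact: c0.
Qed.

Lemma wlim_finite c N : (forall i, (N <= i)%N -> c i = false) ->
  wbounded w c /\ wlim w c = wsum w c 0 N.
Proof.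
move=> c0; have b : wbounded w c.
  by exists (wsum w c 0 N) => M; exact: wsum_finite.
split=> //; apply/eqP; rewrite eq_le wlim_ub // andbT.
by apply: wlim_le => M; exact: wsum_finite.
Qed.

End Nonneg.

Definition geo (i : nat) : R := (3 ^+ i)^-1.

Lemma geo_gt0 i : 0 < geo i.
Proof. by rewrite invr_gt0 exprn_gt0. Qed.

Lemma geo_ge0 i : 0 <= geo i.
Proof. exact/ltW/geo_gt0. Qed.

Lemma geoS i : geo i.+1 = geo i / 3.
Proof. by rewrite /geo exprS invfM mulrC. Qed.

Lemma geo_le i j : (i <= j)%N -> geo j <= geo i.
Proof.
move=> /subnK <-; elim: (j - i)%N => [|k IH]; first by rewrite add0n.
rewrite addSn geoS; have := geo_gt0 (k + i); lra.
Qed.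

Lemma geo_sum N M : (N <= M)%N ->
  \sum_(N <= i < M) geo i = 3 / 2 * (geo N - geo M).
Proof.
move=> /subnK <-; elim: (M - N)%N => [|k IH].
  by rewrite add0n big_geq // subrr mulr0.
by rewrite addSn big_nat_recr ?leq_addl //= IH geoS; lra.
Qed.

Lemma geo_small e : 0 < e -> exists N, geo N < e.
Proof.
move=> e0.
have geoN n : geo n <= n.+1%:R^-1.
  rewrite lef_pV2 ?posrE ?exprn_gt0 // -natrX ler_nat.
  by rewrite -[n.+1]/(n.+1)%N; elim: n => // n IH; rewrite expnS; lia.
exists (Num.truncn e^-1); apply: le_lt_trans (geoN _) _.
rewrite -[ltRHS]invrK ltf_pV2 ?posrE ?invr_gt0 //.
exact: truncnS_gt.
Qed.

(** The weights are 1, 1/3, 1/9, ...: a digit outweighs all later digits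
    together, so that the code embeds the Cantor space in the line. *)
Definition code c : R := wlim geo c.

Lemma wsum_geo_bound c N M : wsum geo c 0 M <= wsum geo c 0 N + 3 / 2 * geo N.
Proof.
have t0 := geo_gt0 N.
have [MN|/ltnW NM] := leqP M N.
  by have := wsum_homor geo_ge0 c 0 MN; lra.
rewrite (@wsum_cat geo c 0 N M) // lerD2l.
apply: le_trans (wsum_le_all geo_ge0 _ _ _) _.
rewrite geo_sum //; have := geo_gt0 M; lra.
Qed.

Lemma wbounded_geo c : wbounded geo c.
Proof. by exists (wsum geo c 0 0 + 3 / 2 * geo 0) => M; exact: wsum_geo_bound. Qed.

Lemma code_bounds c N :
  wsum geo c 0 N <= code c <= wsum geo c 0 N + 3 / 2 * geo N.
Proof.
rewrite wlim_ub //=; last exact: wbounded_geo.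
by apply: wlim_le => // M; exact: wsum_geo_bound.
Qed.

Lemma code_agree N c d : agree N c d -> `|code c - code d| <= 3 / 2 * geo N.
Proof.
move=> cd; have := code_bounds c N; have := code_bounds d N.
rewrite (@eq_wsum geo c d) => [|i /andP[_ /cd //]].
by rewrite ler_norml => /andP[? ?] /andP[? ?]; apply/andP; split; lra.
Qed.

(** At the first digit where the sequences differ the codes differ by at least
    half of its weight, because the later digits weigh at most half as much. *)
Lemma code_separated N c d : `|code c - code d| < geo N / 2 -> agree N.+1 c d.
Proof.
suff H : forall c d n, (n <= N)%N -> agree n c d -> c n -> ~~ d n ->
    geo N / 2 <= code c - code d.
  move=> cd i; elim/ltn_ind: i => n IH nN.
  have agr : agree n c d by move=> k kn; apply: IH => //; exact: ltn_trans nN.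
  case cn : (c n); case dn : (d n) => //.
    have := H _ _ n nN agr; rewrite cn dn => /(_ isT isT).
    by have := ler_norm (code c - code d); lra.
  have agr' : agree n d c by move=> k /agr.
  have := H _ _ n nN agr'; rewrite cn dn => /(_ isT isT).
  by have := ler_norm (- (code c - code d)); rewrite normrN; lra.
move=> {}c {}d n nN cd cn dn.
have /andP[C _] := code_bounds c n.+1; have /andP[_ D] := code_bounds d n.+1.
move: C D; rewrite !wsum_recr // cn (negbTE dn) geoS.
rewrite (@eq_wsum geo c d) => [|i /andP[_ /cd //]].
have := geo_le nN; have := geo_gt0 N; lra.
Qed.

Definition harm (i : nat) : R := i.+1%:R^-1.

Lemma harm_gt0 i : 0 < harm i.
Proof. by rewrite invr_gt0 ltr0n. Qed.

Lemma harm_ge0 i : 0 <= harm i.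
Proof. exact/ltW/harm_gt0. Qed.

Lemma harm_small e : 0 < e -> exists N, forall i, (N <= i)%N -> harm i < e.
Proof.
move=> e0; exists (Num.truncn e^-1) => i Ni.
rewrite -[ltRHS]invrK ltf_pV2 ?posrE ?invr_gt0 ?ltr0n //.
apply: lt_le_trans (truncnS_gt _) _; by rewrite ler_nat ltnS.
Qed.

Lemma harm_diverge N B : exists M, (N <= M)%N /\ B < \sum_(N <= i < M) harm i.
Proof.
apply: contrapT => /forallNP H; apply: (@dvg_harmonic R).
apply: nondecreasing_is_cvgn.
  apply/nondecreasing_seqP => n; rewrite /series /= big_nat_recr //= lerDl.
  exact: harm_ge0.
exists (\sum_(0 <= i < N) harm i + Num.max 0 B) => _ [M _ <-].
rewrite /series /= -/harm.
have [MN|/ltnW NM] := leqP M N.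
  apply: (@le_trans _ _ (\sum_(0 <= i < N) harm i)).
    rewrite (big_cat_nat (leq0n M) MN) /= lerDl.
    by apply: sumr_ge0 => i _; exact: harm_ge0.
  by rewrite lerDl le_max lexx.
rewrite (big_cat_nat (leq0n N) NM) /= lerD2l.
by have /not_andP[//|/negP] := H M; rewrite -leNgt => h; rewrite le_max h orbT.
Qed.

End WeightedSums.

(** * The points of the space and their neighbourhoods *)

Section Space.
Variable R : realType.
Implicit Types (c d : nat -> bool) (s : R).

Definition psum c m N : R := wsum (@harm R) c m N.

(** Used for sequences with bounded partial sums only. *)
Definition mass c : R := wlim (@harm R) c.

(** The condition on c at Y-level j is [dead j.+1 c]; the digits 0, ..., j.+1 do
    not enter, so it depends on the Y-vertex only.  It concerns partial sums, so
    that it passes to limits of sequences. *)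
Definition dead n c : Prop := forall N, psum c n.+1 N < n%:R.

Definition nonzero c : Prop := exists j, c j.

(** The position of the first 1, with the value 0 for the zero sequence. *)
Definition lev c : nat :=
  if pselect (nonzero c) is left h then ex_minn h else 0%N.

Lemma lev_on c : nonzero c -> c (lev c).
Proof. by rewrite /lev; case: pselect => // h _; case: ex_minnP. Qed.

Lemma lev_below c i : (i < lev c)%N -> c i = false.
Proof.
rewrite /lev; case: pselect => // h; case: ex_minnP => m _ mmin im.
by apply/negbTE; apply: contraL im => /mmin; rewrite -leqNgt.
Qed.

Lemma lev_unique c j : c j -> (forall i, (i < j)%N -> c i = false) ->
  lev c = j.
Proof.
move=> cj c0; have nc : nonzero c by exists j.
apply/eqP; rewrite eqn_leq; apply/andP; split; rewrite leqNgt; apply/negP.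
  by move=> /lev_below; rewrite cj.
by move=> /c0; rewrite lev_on.
Qed.

Lemma lev_agree c d N : nonzero d -> (lev d < N)%N -> agree N c d ->
  lev c = lev d.
Proof.
move=> nd dN cd; apply: lev_unique => [|i id].
  by rewrite cd // lev_on.
by rewrite cd ?(lev_below id) //; exact: ltn_trans dN.
Qed.

Lemma psum_agree c d m N M : (N <= M)%N -> agree M c d ->
  psum c m N = psum d m N.
Proof.
move=> NM cd; apply: eq_wsum => i /andP[_ iN]; apply: cd; exact: leq_trans NM.
Qed.

Lemma dead_mono m n c : (m <= n)%N -> dead m c -> dead n c.
Proof.
move=> mn dm N; apply: le_lt_trans (wsum_homol (@harm_ge0 R) c N (mn : m.+1 <= n.+1)%N) _.
by apply: lt_le_trans (dm N) _; rewrite ler_nat.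
Qed.

Lemma not_dead n c : ~ dead n c -> exists N, n%:R <= psum c n.+1 N.
Proof. by move=> /existsNP[N /negP]; rewrite -leNgt => h; exists N. Qed.

(** A two-dimensional array of bits that determines the Y-vertex of c.  Row i
    tells whether the first 1 occurs by i; whether the sum up to i already shows
    that the vertex is not dead; and, only in that case, the digits after the one
    that the vertex forgets.  For a dead vertex nothing but the level is
    revealed, which is the collapse to one point, and each bit depends on
    finitely many digits, which makes the collapse continuous. *)
Definition ebit c (i k : nat) : bool :=
  match k with
  | 0 => (lev c <= i)%N
  | 1 => (lev c).+1%:R <= psum c (lev c).+2 i
  | k'.+2 => [&& (lev c).+1%:R <= psum c (lev c).+2 i,
                 ((lev c).+2 <= k')%N & c k']
  end.

Definition yseq c (n : nat) : bool :=
  if @unpickle (nat * nat)%type n is Some ik then ebit c ik.1 ik.2 else false.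

Definition xcode c : R := code R (fun i => c i.+1).
Definition ycode c : R := code R (yseq c).

(** The point at height s of the segment from (x, 0, 0) to (0, y, 1), where x and
    y are the codes of the two ends of the edge c. *)
Definition pt c s : 'rV[R]_3 :=
  \row_(j < 3) nth 0 [:: (1 - s) * xcode c; s * ycode c; s] j.

Definition coordX : 'I_3 := @Ordinal 3 0 isT.
Definition coordY : 'I_3 := @Ordinal 3 1 isT.
Definition coordS : 'I_3 := @Ordinal 3 2 isT.

Lemma pt_X c s : pt c s ord0 coordX = (1 - s) * xcode c. Proof. by rewrite mxE. Qed.
Lemma pt_Y c s : pt c s ord0 coordY = s * ycode c. Proof. by rewrite mxE. Qed.
Lemma pt_S c s : pt c s ord0 coordS = s. Proof. by rewrite mxE. Qed.

Lemma row3_eq (p q : 'rV[R]_3) : p ord0 coordX = q ord0 coordX ->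
  p ord0 coordY = q ord0 coordY -> p ord0 coordS = q ord0 coordS -> p = q.
Proof.
move=> h0 h1 h2; apply/rowP => -[[|[|[|//]]] hj].
- by rewrite (_ : Ordinal hj = coordX) //; apply/val_inj.
- by rewrite (_ : Ordinal hj = coordY) //; apply/val_inj.
- by rewrite (_ : Ordinal hj = coordS) //; apply/val_inj.
Qed.

Lemma row3_near (Q : set 'rV[R]_3) (p : 'rV[R]_3) : open Q -> Q p ->
  exists2 e : R, 0 < e & forall q : 'rV[R]_3,
    `|p ord0 coordX - q ord0 coordX| < e -> `|p ord0 coordY - q ord0 coordY| < e ->
    `|p ord0 coordS - q ord0 coordS| < e -> Q q.
Proof.
rewrite openE => /[apply]; rewrite /interior => /nbhs_ballP[e /= e0 eO].
exists e => // q h0 h1 h2; apply: eO; split=> // i j.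
rewrite (ord1 i) /ball /=; move: j => -[[|[|[|//]]] hj].
- by rewrite (_ : Ordinal hj = coordX) //; apply/val_inj.
- by rewrite (_ : Ordinal hj = coordY) //; apply/val_inj.
- by rewrite (_ : Ordinal hj = coordS) //; apply/val_inj.
Qed.

Lemma code_ge0 c : 0 <= code R c.
Proof. by have /andP[] := code_bounds R c 0; rewrite wsum_geq. Qed.

Lemma code_le c : code R c <= 3 / 2.
Proof.
have /andP[_] := code_bounds R c 0.
by rewrite wsum_geq // /geo expr0 invr1 add0r mulr1.
Qed.

Lemma pt_near (Q : set 'rV[R]_3) c0 s0 : open Q -> Q (pt c0 s0) ->
  exists2 e : R, 0 < e & forall c s, 0 <= s <= 1 ->
    `|xcode c - xcode c0| < e -> `|ycode c - ycode c0| < e ->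
    `|s - s0| < e -> Q (pt c s).
Proof.
move=> oO /(row3_near oO)[e e0 eO]; exists (e / 3); first by rewrite divr_gt0.
move=> c s /andP[s_ge0 s_le1] xe ye se; apply: eO; rewrite !(pt_X, pt_Y, pt_S).
- have -> : (1 - s0) * xcode c0 - (1 - s) * xcode c =
    (s - s0) * xcode c0 - (1 - s) * (xcode c - xcode c0) by ring.
  apply: le_lt_trans (ler_normB _ _) _; rewrite !normrM.
  have x0 := code_ge0 (fun i => c0 i.+1); have x1 := code_le (fun i => c0 i.+1).
  rewrite (ger0_norm x0) (@ger0_norm _ (1 - s)) ?subr_ge0 //.
  rewrite -/(xcode c0) in x0 x1 *.
  have := normr_ge0 (s - s0); have := normr_ge0 (xcode c - xcode c0); nra.
- have -> : s0 * ycode c0 - s * ycode c =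
    - ((s - s0) * ycode c0 + s * (ycode c - ycode c0)) by ring.
  rewrite normrN; apply: le_lt_trans (ler_normD _ _) _; rewrite !normrM.
  have x0 := code_ge0 (yseq c0); have x1 := code_le (yseq c0).
  rewrite (ger0_norm x0) (@ger0_norm _ s) //.
  rewrite -/(ycode c0) in x0 x1 *.
  have := normr_ge0 (s - s0); have := normr_ge0 (ycode c - ycode c0); nra.
- by rewrite distrC; lra.
Qed.

Lemma code_agree_lt e : 0 < e -> exists N, forall c d, agree N c d ->
  `|code R c - code R d| < e.
Proof.
move=> e0; have [|N tN] := @geo_small R (e / 2); first by rewrite divr_gt0.
by exists N => c d /(code_agree R) h; apply: le_lt_trans h _; lra.
Qed.

Lemma ebit_agree c0 i k : nonzero c0 ->
  exists N, forall c, agree N c c0 -> ebit c i k = ebit c0 i k.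
Proof.
move=> n0; exists (maxn (lev c0).+1 (maxn i k)) => c cc.
have lc : lev c = lev c0 by apply: lev_agree cc => //; rewrite leq_max leqnn.
have pc m : psum c m i = psum c0 m i.
  by apply: psum_agree cc; rewrite !leq_max leqnn !orbT.
case: k cc => [|[|k]] cc; rewrite /ebit lc ?pc //.
by rewrite [c k]cc // !leq_max leqnSn !orbT.
Qed.

Lemma yseq_agree c0 M : nonzero c0 ->
  exists N, forall c, agree N c c0 -> agree M (yseq c) (yseq c0).
Proof.
move=> n0; elim: M => [|M [N IH]]; first by exists 0%N.
have [N' hN'] : exists N', forall c, agree N' c c0 -> yseq c M = yseq c0 M.
  rewrite /yseq; case: unpickle => [[i k]|]; last by exists 0%N.
  exact: ebit_agree.
exists (maxn N N') => c cc i; rewrite ltnS leq_eqVlt => /orP[/eqP ->|iM].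
  by apply: hN' => j jN; apply: cc; rewrite leq_max jN orbT.
by apply: IH iM => j jN; apply: cc; rewrite leq_max jN.
Qed.

Lemma pt_continuous (Q : set 'rV[R]_3) c0 s0 : nonzero c0 -> open Q ->
  Q (pt c0 s0) -> exists N, exists2 e : R, 0 < e &
    forall c s, agree N c c0 -> 0 <= s <= 1 -> `|s - s0| < e -> Q (pt c s).
Proof.
move=> n0 oO /(pt_near oO)[e e0 eO].
have [M hM] := code_agree_lt e0; have [N hN] := yseq_agree M n0.
exists (maxn M.+1 N), e => // c s cc s01 se; apply: eO => //.
  apply: hM => i iM; apply: cc; rewrite leq_max ltnS iM //.
by apply: hM; apply: hN => i iN; apply: cc; rewrite leq_max iN orbT.
Qed.

(** Continuity at a Y-vertex needs the revealed bits only: this is how points of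
    other strands come close to a collapsed vertex. *)
Lemma pt_Y_continuous (Q : set 'rV[R]_3) c0 : open Q ->
  Q (pt c0 1) -> exists M, forall c, agree M (yseq c) (yseq c0) -> Q (pt c 1).
Proof.
move=> oO /(row3_near oO)[e e0 eO]; have [M hM] := code_agree_lt e0.
exists M => c /hM h; apply: eO; rewrite !(pt_X, pt_Y, pt_S).
- by rewrite !subrr !mul0r subrr normr0.
- by rewrite !mul1r distrC.
- by rewrite subrr normr0.
Qed.

Lemma pt_X_eq c d : (forall i, (0 < i)%N -> c i = d i) -> pt c 0 = pt d 0.
Proof.
move=> cd; apply: row3_eq; rewrite !(pt_X, pt_Y, pt_S) ?mul0r //.
congr (_ * code R _); apply: funext => i; exact: cd.
Qed.

Lemma pt_Y_eq c d : yseq c = yseq d -> pt c 1 = pt d 1.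
Proof.
by move=> cd; apply: row3_eq; rewrite !(pt_X, pt_Y, pt_S) ?subrr ?mul0r // /ycode cd.
Qed.

Lemma continuous_coord (j : 'I_3) : continuous (fun p : 'rV[R]_3 => p ord0 j).
Proof. exact: coord_continuous. Qed.

Lemma open_positive (f : 'rV[R]_3 -> R) : continuous f -> open [set p | 0 < f p].
Proof. by move=> cf; exact: (open_comp (fun x _ => cf x) (@open_gt R 0)). Qed.

Lemma continuous_sub (T : topologicalType) (f g : T -> R) :
  continuous f -> continuous g -> continuous (fun p => f p - g p).
Proof. by move=> cf cg p; apply: cvgB; [exact: cf | exact: cg]. Qed.

Lemma continuous_mulr (T : topologicalType) (f : T -> R) (z : R) :
  continuous f -> continuous (fun p => f p * z).
Proof. by move=> cf p; apply: cvgM; [exact: cf | exact: cvg_cst]. Qed.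

Lemma continuous_constant (T : topologicalType) (z : R) : continuous (fun _ : T => z).
Proof. by move=> p; exact: cvg_cst. Qed.

Lemma continuous_norm (T : topologicalType) (f : T -> R) :
  continuous f -> continuous (fun p => `|f p|).
Proof. by move=> cf p; apply: cvg_norm; exact: cf. Qed.

Lemma open_height s0 (e : R) : open [set p : 'rV[R]_3 | `|p ord0 coordS - s0| < e].
Proof.
rewrite (_ : mkset _ = [set p : 'rV[R]_3 | 0 < e - `|p ord0 coordS - s0|]).
  apply: open_positive; apply: continuous_sub; first exact: continuous_constant.
  by apply: continuous_norm; apply: continuous_sub;
    [exact: continuous_coord | exact: continuous_constant].
by apply/seteqP; split=> p /=; rewrite subr_gt0.
Qed.

(** The points of the join whose X-coordinate is close to that of a given edge;
    multiplying by [1 - s] avoids the division, and excludes the Y-vertices. *)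
Lemma open_cone_X (x0 e : R) :
  open [set p : 'rV[R]_3 |
    `|p ord0 coordX - (1 - p ord0 coordS) * x0| < (1 - p ord0 coordS) * e].
Proof.
rewrite (_ : mkset _ = [set p : 'rV[R]_3 |
  0 < (1 - p ord0 coordS) * e - `|p ord0 coordX - (1 - p ord0 coordS) * x0|]).
  have c1 (z : R) : continuous (fun p : 'rV[R]_3 => (1 - p ord0 coordS) * z).
    by apply: continuous_mulr; apply: continuous_sub;
      [exact: continuous_constant | exact: continuous_coord].
  apply: open_positive; apply: continuous_sub; first exact: c1.
  by apply: continuous_norm; apply: continuous_sub; [exact: continuous_coord | exact: c1].
by apply/seteqP; split=> p /=; rewrite subr_gt0.
Qed.

Lemma open_cone_Y (y0 e : R) :
  open [set p : 'rV[R]_3 | `|p ord0 coordY - p ord0 coordS * y0| < p ord0 coordS * e].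
Proof.
rewrite (_ : mkset _ = [set p : 'rV[R]_3 |
  0 < p ord0 coordS * e - `|p ord0 coordY - p ord0 coordS * y0|]).
  have c1 (z : R) : continuous (fun p : 'rV[R]_3 => p ord0 coordS * z).
    by apply: continuous_mulr; exact: continuous_coord.
  apply: open_positive; apply: continuous_sub; first exact: c1.
  by apply: continuous_norm; apply: continuous_sub; [exact: continuous_coord | exact: c1].
by apply/seteqP; split=> p /=; rewrite subr_gt0.
Qed.

(** Away from the Y-vertices a point determines all digits except digit 0. *)
Lemma near_digits c0 s0 N : s0 < 1 -> exists Q : set 'rV[R]_3,
  [/\ open Q, Q (pt c0 s0) & forall c s, s <= 1 -> Q (pt c s) ->
    forall i, (0 < i <= N)%N -> c i = c0 i].
Proof.
move=> s1; pose e := geo R N / 2; have e0 : 0 < e by rewrite divr_gt0 ?geo_gt0.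
exists [set p : 'rV[R]_3 |
  `|p ord0 coordX - (1 - p ord0 coordS) * xcode c0| < (1 - p ord0 coordS) * e].
split; first exact: open_cone_X.
  by rewrite /= pt_X pt_S subrr normr0 mulr_gt0 // subr_gt0.
move=> c s; rewrite le_eqVlt => /orP[/eqP ->|sl1] /=; rewrite pt_X pt_S.
  by rewrite subrr !mul0r subrr normr0 ltxx.
have s1' : 0 < 1 - s by rewrite subr_gt0.
rewrite -mulrBr normrM (gtr0_norm s1') ltr_pM2l // => /code_separated h.
by case=> // i /andP[_ iN]; rewrite h // ltnW.
Qed.

(** Away from the X-vertices a point determines the Y-vertex of its edge. *)
Lemma near_yseq c0 s0 M : 0 < s0 -> exists Q : set 'rV[R]_3,
  [/\ open Q, Q (pt c0 s0) & forall c s, 0 <= s -> Q (pt c s) ->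
    agree M (yseq c) (yseq c0)].
Proof.
move=> s1; pose e := geo R M / 2; have e0 : 0 < e by rewrite divr_gt0 ?geo_gt0.
exists [set p : 'rV[R]_3 |
  `|p ord0 coordY - p ord0 coordS * ycode c0| < p ord0 coordS * e].
split; first exact: open_cone_Y.
  by rewrite /= pt_Y pt_S subrr normr0 mulr_gt0.
move=> c s; rewrite le_eqVlt => /orP[/eqP <-|sl1] /=; rewrite pt_Y pt_S.
  by rewrite !mul0r subrr normr0 ltxx.
rewrite -mulrBr normrM (gtr0_norm sl1) ltr_pM2l // => /code_separated h.
by move=> i iM; apply: h; exact: ltnW.
Qed.

Lemma near_bits c0 s0 N : 0 < s0 -> exists Q : set 'rV[R]_3,
  [/\ open Q, Q (pt c0 s0) & forall c s, 0 <= s -> Q (pt c s) ->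
    forall i k, (i < N)%N -> (k < N)%N -> ebit c i k = ebit c0 i k].
Proof.
move=> s1.
pose M := \max_(i < N) \max_(k < N) (@pickle (nat * nat)%type (i : nat, k : nat)).
have [Q [oO O0 OP]] := near_yseq c0 M.+1 s1; exists Q; split=> // c s s_ge0 /OP.
move=> /(_ s_ge0) cc i k iN kN.
have := cc (@pickle (nat * nat)%type (i, k)); rewrite /yseq pickleK /=; apply.
rewrite ltnS.
apply: leq_trans (leq_bigmax (F := fun i : 'I_N =>
   \max_(k < N) (@pickle (nat * nat)%type (i : nat, k : nat))) (Ordinal iN)).
exact: (leq_bigmax (F := fun k : 'I_N =>
   (@pickle (nat * nat)%type (i, k : nat))) (Ordinal kN)).
Qed.

Lemma near_lev c0 s0 N : 0 < s0 -> exists Q : set 'rV[R]_3,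
  [/\ open Q, Q (pt c0 s0) & forall c s, 0 <= s -> Q (pt c s) ->
    lev c = lev c0 /\
    forall i k, (i < N)%N -> (k < N)%N -> ebit c i k = ebit c0 i k].
Proof.
move=> s1; have [Q [oO O0 OP]] := near_bits c0 (maxn N (lev c0).+1) s1.
exists Q; split=> // c s s_ge0 /(OP _ _ s_ge0) b; split; last first.
  by move=> i k iN kN; apply: b; rewrite leq_max ?iN ?kN.
apply/eqP; rewrite eqn_leq; apply/andP; split.
  by have := b (lev c0) 0%N; rewrite /= !leq_max leqnn !orbT => ->.
case E : (lev c0) => [//|l].
have := b l 0%N; rewrite /= E !leq_max !ltnS leqnSn !orbT => /(_ isT isT).
by rewrite ltnn leqNgt => /negbFE.
Qed.

Lemma near_alive c0 s0 N : 0 < s0 -> ~ dead (lev c0).+1 c0 ->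
  exists Q : set 'rV[R]_3,
  [/\ open Q, Q (pt c0 s0) & forall c s, 0 <= s -> Q (pt c s) ->
    lev c = lev c0 /\ forall k, ((lev c0).+2 <= k < N)%N -> c k = c0 k].
Proof.
move=> s1 /not_dead[i hi].
have [Q [oO O0 OP]] := near_lev c0 (maxn i N).+3 s1.
exists Q; split=> // c s s_ge0 /(OP _ _ s_ge0)[lc b]; split=> // k /andP[lk kN].
have i3 : (i < (maxn i N).+3)%N by have := leq_maxl i N; lia.
have := b i 1%N i3 isT; rewrite /= lc hi => ex.
have := b i k.+2 i3; rewrite /= lc ex hi lk /=; apply.
by have := leq_maxr i N; lia.
Qed.

(** Near a collapsed vertex, a sequence looks dead up to any given position. *)
Lemma near_dead c0 s0 N : 0 < s0 -> dead (lev c0).+1 c0 ->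
  exists Q : set 'rV[R]_3,
  [/\ open Q, Q (pt c0 s0) & forall c s, 0 <= s -> Q (pt c s) ->
    lev c = lev c0 /\ psum c (lev c0).+2 N < (lev c0).+1%:R].
Proof.
move=> s1 d0.
have [Q [oO O0 OP]] := near_lev c0 N.+2 s1.
exists Q; split=> // c s s_ge0 /(OP _ _ s_ge0)[lc b]; split=> //.
have := b N 1%N; rewrite /= lc leqnSn => /(_ isT isT).
by rewrite ltNge => ->; rewrite -ltNge.
Qed.

(** Inside an edge the digit 0 is known too: it is 1 exactly if the level is 0. *)
Lemma near_edge c0 s0 N : 0 < s0 -> s0 < 1 -> nonzero c0 ->
  exists Q : set 'rV[R]_3,
  [/\ open Q, Q (pt c0 s0) & forall c s, nonzero c -> 0 <= s <= 1 ->
    Q (pt c s) -> lev c = lev c0 /\ agree N c c0].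
Proof.
move=> s1 s2 n0.
have [Q [oO O0 OP]] := near_lev c0 0 s1.
have [Q' [oO' O0' OP']] := near_digits c0 N s2.
exists (Q `&` Q'); split=> //; first exact: openI.
move=> c s nc /andP[s_ge0 s_le1] [/(OP _ _ s_ge0)[lc _] /(OP' _ _ s_le1) h].
split=> //; case=> [_|i iN]; last by apply: h; apply: ltnW.
case E : (lev c0) => [|l].
  by have := lev_on nc; rewrite lc; have := lev_on n0; rewrite E => -> ->.
by rewrite (@lev_below c) ?(@lev_below c0) ?lc ?E.
Qed.

(** Both ends of every edge of finite mass are kept.  The interior point sits at
    the height congruent to the mass modulo 1, on living edges only. *)
Definition valid c s : Prop :=
  [/\ nonzero c, wbounded (@harm R) c, 0 <= s <= 1 &
    [\/ s = 0, s = 1 |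
        ~ dead (lev c).+1 c /\ exists k : nat, mass c = k%:R + s]].

Definition wpoints : set 'rV[R]_3 := [set p | exists c s, valid c s /\ p = pt c s].

End Space.

(** * Nondense connected subsets have at most one point *)

Section Hereditary.
Variable R : realType.
Implicit Types (c d u v w : nat -> bool) (s : R) (A : set 'rV[R]_3).

(** A vertex has several representations [(c, s)]; statements about all of them
    include that a quantity is well defined on A. *)
Definition rep A c s : Prop := valid c s /\ A (pt c s).

Definition locally_constant A (T : Type) (phi : (nat -> bool) -> R -> T) :=
  forall c0 s0, rep A c0 s0 -> exists Q : set 'rV[R]_3,
    [/\ open Q, Q (pt c0 s0) &
        forall c s, rep A c s -> Q (pt c s) -> phi c s = phi c0 s0].

Definition degenerate A : Prop := forall p q, A p -> A q -> p = q.

Lemma connected_locally_constant A (T : Type) (phi : (nat -> bool) -> R -> T) :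
  connected A -> A `<=` @wpoints R -> locally_constant A phi ->
  forall c s c' s', rep A c s -> rep A c' s' -> phi c s = phi c' s'.
Proof.
move=> cA AW lphi c1 s1 c2 s2 r1 r2.
pose P (b : Prop) := [set Q : set 'rV[R]_3 | open Q /\
  forall c s, rep A c s -> Q (pt c s) -> (phi c s = phi c1 s1 <-> b)].
pose U b := \bigcup_(Q in P b) Q.
have oU b : open (U b) by apply: bigcup_open => Q [].
have AU p : A p -> U True p \/ U False p.
  move=> Ap; have [c [s [v pE]]] := AW _ Ap; rewrite pE in Ap *.
  have [Q [oQ Qp QP]] := lphi _ _ (conj v Ap).
  have [e|ne] := pselect (phi c s = phi c1 s1); [left|right]; exists Q => //;
    by split=> // c' s' r' /(QP _ _ r') ->.
have disj p : A p -> U True p -> U False p -> False.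
  move=> Ap [Q [_ h] Qp] [Q' [_ h'] Qp'].
  have [c [s [v pE]]] := AW _ Ap; rewrite pE in Ap Qp Qp'.
  by apply/(h' _ _ (conj v Ap) Qp'); apply/(h _ _ (conj v Ap) Qp).
have [v1 A1] := r1.
have E : A `&` U True = A.
  apply: cA.
  - exists (pt c1 s1); split=> //; case: (AU _ A1) => // -[Q [_ h] Q1].
    by have /iffLR := h _ _ r1 Q1; move=> /(_ erefl).
  - by exists (U True).
  - exists (~` U False); first by rewrite closedC.
    apply/seteqP; split=> p [Ap Up]; split=> //; first by move=> /(disj _ Ap Up).
    by case: (AU _ Ap) => // /Up.
have [v2 A2] := r2.
have [_ [Q [_ h] Q2]] : (A `&` U True) (pt c2 s2) by rewrite E.
by apply/esym/(h _ _ r2 Q2).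
Qed.

Lemma connected_finite A : connected A -> finite_set A -> degenerate A.
Proof.
move=> cA fA p q Ap Aq.
have T1 : accessible_space 'rV[R]_3.
  by apply: hausdorff_accessible; exact: norm_hausdorff.
have cf (B : set 'rV[R]_3) : finite_set B -> closed B.
  by move: B; apply/accessible_finite_set_closed.
suff E : [set p] = A by move: Aq; rewrite -E => ->.
apply: cA; first by exists p.
- exists (~` (A `\ p)).
    by rewrite openC; apply: cf; apply: sub_finite_set fA => x [].
  apply/seteqP; split=> [x ->|x [Ax nx]] /=; first by split=> // -[_ /(_ erefl)].
  by apply: contrapT => xp; apply: nx.
- exists [set p]; first exact: cf.
  by apply/seteqP; split=> [x ->|x []].
Qed.

(** A contains at most three points of each of finitely many edges. *)
Lemma tail_fixed_degenerate A c0 n : connected A -> A `<=` @wpoints R ->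
  (forall c s, rep A c s -> forall k, (n < k)%N -> c k = c0 k) -> degenerate A.
Proof.
move=> cA AW Ac; apply: connected_finite => //.
pose cf (f : {ffun 'I_n.+1 -> bool}) (i : nat) : bool :=
  if (i <= n)%N then f (inord i) else c0 i.
pose g (fk : {ffun 'I_n.+1 -> bool} * 'I_3) : 'rV[R]_3 :=
  let m := mass R (cf fk.1) in
  pt (cf fk.1) (nth 0 [:: 0; 1; m - (Num.truncn m)%:R] fk.2).
apply: (@sub_finite_set _ _ (g @` [set: _])); last first.
  exact: finite_image.
move=> p Ap; have [c [s [v pE]]] := AW _ Ap; rewrite pE in Ap *.
have E : cf [ffun i : 'I_n.+1 => c i] = c.
  apply: funext => i; rewrite /cf; case: leqP => ik; first by rewrite ffunE inordK.
  by rewrite (Ac c s (conj v Ap)).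
have [nc bc /andP[s_ge0 s_le1] D] := v.
have [s1|s1] := eqVneq s 1.
  by exists ([ffun i : 'I_n.+1 => c i], coordY) => //; rewrite /g /= E s1.
case: D => [->|/eqP|[_ [k kE]]]; last 2 first.
- by rewrite (negbTE s1).
- exists ([ffun i : 'I_n.+1 => c i], coordS) => //; rewrite /g /= E.
  congr pt; rewrite (@truncn_def _ _ k) ?kE ?(addrC k%:R) ?addrK //.
  by rewrite lerDr s_ge0 /= -natr1 addrC ltrD2l lt_neqAle s1.
by exists ([ffun i : 'I_n.+1 => c i], coordX) => //; rewrite /g /= E.
Qed.

(** The digits after position n, as seen from the first N digits: they are
    revealed only when these show that c is not dead at n.  So the value is
    [None] near a collapsed vertex of level below n, although the strands that
    pass there have different digits. *)
Definition visible_tail n N c : option (nat * (nat -> bool)) :=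
  if n%:R <= psum R c n.+1 N
  then Some (n, fun k => (n < k < N)%N && c k) else None.

Lemma visible_tail_eq n N c d : (forall k, (n < k < N)%N -> c k = d k) ->
  visible_tail n N c = visible_tail n N d.
Proof.
move=> cd; rewrite /visible_tail /psum (@eq_wsum R _ c d) //; case: ifP => // _.
by congr (Some (_, _)); apply: funext => k; case: (boolP (n < k < N)%N) => // /cd.
Qed.

Lemma visible_tail_none m n N c : (m <= n)%N -> psum R c m.+1 N < m%:R ->
  visible_tail n N c = None.
Proof.
move=> mn h; rewrite /visible_tail ifF //; apply/negbTE; rewrite -ltNge.
apply: le_lt_trans (wsum_homol (@harm_ge0 R) c N (mn : m.+1 <= n.+1)%N) _.
by apply: lt_le_trans h _; rewrite ler_nat.
Qed.

Lemma dead_yseq c d : lev c = lev d -> dead R (lev c).+1 c ->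
  dead R (lev d).+1 d -> yseq R c = yseq R d.
Proof.
move=> l dc dd; apply: funext => n; rewrite /yseq.
case: unpickle => // -[i [|[|k]]]; rewrite /ebit /= ?l //.
  by have := dc i; have := dd i; rewrite l !ltNge => /negbTE -> /negbTE ->.
by have := dc i; have := dd i; rewrite l !ltNge => /negbTE -> /negbTE ->.
Qed.

(** Here t is the level at which the strand through a point of A is examined.  If
    some tail is visible, all points of A share it, beyond the same level, and A
    is finite.  Otherwise all strands are dead at t.  Suppose that a Y-vertex of
    level at least n - 1 belongs to A.  The edges that reach it within A are dead
    there, so they have no interior points nearby: the vertex is isolated in A,
    hence it is all of A. *)
Lemma degenerate_or_dead A n (t : (nat -> bool) -> R -> nat) (e : R) :
  connected A -> A `<=` @wpoints R -> 0 < e ->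
  (forall N, locally_constant A (fun c s => visible_tail (t c s) N c)) ->
  (forall c s, rep A c s -> 1 - e < s -> (n <= (lev c).+1)%N ->
     dead R (t c s) c -> dead R (lev c).+1 c) ->
  degenerate A \/ forall c s, rep A c s ->
    dead R (t c s) c /\ (s = 1 -> ((lev c).+1 < n)%N).
Proof.
move=> cA AW e0 lt ht.
have [[c0 [s0 [N [r0 hN]]]]|none] := pselect (exists c s N, rep A c s /\
    (t c s)%:R <= psum R c (t c s).+1 N).
  left; apply: (@tail_fixed_degenerate A c0 (t c0 s0)) => // c s r k tk.
  pose M := maxn N k.+1.
  have := connected_locally_constant cA AW (lt M) r r0.
  rewrite {2}/visible_tail ifT; last first.
    by apply: le_trans hN (wsum_homor (@harm_ge0 R) _ _ _); rewrite leq_maxl.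
  rewrite /visible_tail; case: ifP => // _ [-> /(congr1 (@^~ k))].
  by rewrite tk leq_max leqnn orbT.
have {}none c s : rep A c s -> dead R (t c s) c.
  move=> r N; rewrite ltNge; apply/negP => h; apply: none.
  by exists c, s, N.
have [[c1 [r1 l1]]|noY] := pselect (exists c, rep A c 1 /\ (n <= (lev c).+1)%N).
  left; pose psi c s := (s == 1) && (lev c == lev c1).
  have lpsi : locally_constant A psi.
    move=> c0 s0 r0; have [[nz0 b0 /andP[s_ge0 s_le1] D0] A0] := r0.
    have [sE|sn] := eqVneq s0 1; last first.
      exists [set p : 'rV[R]_3 | `|p ord0 coordS - s0| < 1 - s0].
      have s0_lt1 : 0 < 1 - s0 by rewrite subr_gt0 lt_neqAle sn.
      split; [exact: open_height | by rewrite /= pt_S subrr normr0 |].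
      move=> c s r /=; rewrite pt_S /psi (negbTE sn) /= => h.
      by case: eqVneq h => // ->; rewrite gtr0_norm // ltxx.
    have [|Q [oQ Q0 QP]] := @near_lev R c0 s0 0; first by rewrite sE.
    exists (Q `&` [set p : 'rV[R]_3 | `|p ord0 coordS - s0| < Num.min e 1]); split.
    - by apply: openI => //; exact: open_height.
    - by split=> //=; rewrite pt_S subrr normr0 lt_min e0 ltr01.
    move=> c s r [Qc] /=; rewrite pt_S sE /psi lt_min eqxx /= => /andP[he h1].
    have [[nzc bc /andP[s_ge0' s_le1'] D] Ac] := r.
    have [lc _] := QP _ _ s_ge0' Qc; rewrite lc.
    have [lE|] := eqVneq (lev c0) (lev c1); last by rewrite andbF.
    rewrite andbT; apply/eqP; rewrite ltr_norml in he; rewrite ltr_norml in h1.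
    case: D => [s0E|//|[al _]].
      by case/andP: h1 => ? _; lra.
    case: al; apply: (ht _ _ r); last exact: none.
      by case/andP: he => ? _; lra.
    by rewrite lc lE.
  have all1 c s : rep A c s -> [/\ s = 1, lev c = lev c1 & dead R (lev c).+1 c].
    move=> r; have := connected_locally_constant cA AW lpsi r r1.
    rewrite /psi !eqxx /= => /andP[/eqP s1 /eqP lc]; split=> //.
    apply: (ht _ _ r); [by rewrite s1; lra | by rewrite lc | exact: none].
  move=> p q Ap Aq; have [c [s [v pE]]] := AW _ Ap; have [d [s' [v' qE]]] := AW _ Aq.
  rewrite pE qE in Ap Aq *.
  have [-> lc dc] := all1 _ _ (conj v Ap); have [-> ld dd] := all1 _ _ (conj v' Aq).
  by apply: pt_Y_eq; apply: dead_yseq dc dd; rewrite lc ld.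
right=> c s r; split; first exact: none.
move=> s1; rewrite ltnNge; apply/negP => ln; apply: noY; exists c.
by rewrite -{1}s1.
Qed.

(** Without Y-vertices of level n and above, the digits after n cannot change
    along A, except through collapsed vertices of smaller level, whose strands
    are dead at n as well.  So [degenerate_or_dead] applies with the constant
    level n and removes the next level.  At level 0 no sequence is dead, because
    the empty sum is not negative. *)
Lemma no_high_Y_degenerate n A : connected A -> A `<=` @wpoints R ->
  (forall c, rep A c 1 -> (lev c < n)%N) -> degenerate A.
Proof.
elim: n A => [|n IH] A cA AW lA; last first.
  have [|||//|H] := @degenerate_or_dead A n.+1 (fun _ _ => n.+1) 1 cA AW.
  - exact: ltr01.
  - move=> N c0 s0 r0; have [[nz0 b0 /andP[s_ge0 s_le1] D0] A0] := r0.
    have [sE|sn] := eqVneq s0 1; last first.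
      have [|Q [oQ Q0 QP]] := @near_digits R c0 s0 N; first by rewrite lt_neqAle sn.
      exists Q; split=> // c s [[_ _ /andP[_ s1] _] _] /(QP _ _ s1) h.
      by apply: visible_tail_eq => k /andP[k1 k2]; apply: h; lia.
    have l0 : (lev c0 < n.+1)%N by apply: lA; rewrite -sE.
    have s0_gt0 : 0 < s0 by rewrite sE.
    have [d0|a0] := pselect (dead R (lev c0).+1 c0).
      have [Q [oQ Q0 QP]] := @near_dead R c0 s0 N s0_gt0 d0.
      exists Q; split=> // c s [[_ _ /andP[s0' _] _] _] /(QP _ _ s0')[_ h].
      by rewrite (visible_tail_none _ h) // (visible_tail_none _ (d0 N)).
    have [Q [oQ Q0 QP]] := @near_alive R c0 s0 N s0_gt0 a0.
    exists Q; split=> // c s [[_ _ /andP[s0' _] _] _] /(QP _ _ s0')[_ h].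
    by apply: visible_tail_eq => k /andP[k1 k2]; apply: h; lia.
  - by move=> c s r _ nl; exact: dead_mono.
  - by apply: IH => // c r; have [_ /(_ erefl)] := H _ _ r.
have [|||//|H] := @degenerate_or_dead A 0 (fun _ _ => 0%N) 1 cA AW.
- exact: ltr01.
- move=> N c0 s0 r0; have [[nz0 b0 /andP[s_ge0 s_le1] D0] A0] := r0.
  have [sE|sn] := eqVneq s0 1; first by have := lA c0; rewrite -sE => /(_ r0).
  have [|Q [oQ Q0 QP]] := @near_digits R c0 s0 N; first by rewrite lt_neqAle sn.
  exists Q; split=> // c s [[_ _ /andP[_ s1] _] _] /(QP _ _ s1) h.
  by apply: visible_tail_eq => k /andP[k1 k2]; apply: h; lia.
- by move=> c s r _ nl; exact: dead_mono.
move=> p q Ap; have [c [s [v pE]]] := AW _ Ap; rewrite pE in Ap.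
have [/(_ 0%N)] := H _ _ (conj v Ap).
by rewrite /psum wsum_geq // ltxx.
Qed.

(** The Gray path of the words of length n, cut inside the edge w, has a first
    part, value false, and a second part, value true.  The function tells in
    which part the edge u has its Y-end (e = false) or its X-end (e = true); the
    ends differ for u = w only.  The path for n + 1 runs through the words with last
    digit 0 as the path for n does, then backwards through those with last
    digit 1. *)
Fixpoint side (e : bool) (n : nat) w u : bool :=
  if n is m.+1 then
    if w m == u m then side e m w u (+) w m else u m
  else e.

Lemma side_agree e n w u v : agree n u v -> side e n w u = side e n w v.
Proof.
elim: n => // n IH uv /=; rewrite uv // IH // => i ik; apply: uv; exact: ltnW.
Qed.

Lemma side_uncut e e' n w u : ~ agree n u w -> side e n w u = side e' n w u.
Proof.
elim: n => [[]//|n IH h] /=; case: eqVneq => // wu; congr (_ (+) _).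
apply: IH => a; apply: h => i; rewrite ltnS leq_eqVlt => /orP[/eqP -> //|].
exact: a.
Qed.

(** The next four lemmas say that [side] is constant along the path: it does not
    change across an X-vertex, nor across a Y-vertex of level at most n - 2; and
    at the two ends of the path it takes the two values. *)
Lemma side_X n w u v : (0 < n)%N -> (forall i, (0 < i < n)%N -> u i = v i) ->
  side true n w u = side true n w v.
Proof.
case: n => // n _; elim: n => [|n IH] uv.
  by rewrite /=; case: (w 0%N) (u 0%N) (v 0%N) => [] [] [].
rewrite [LHS]/= [RHS]/= -/(side true n.+1 w u) -/(side true n.+1 w v).
rewrite [side true n.+1 w u]IH; first by rewrite uv // ltnSn.
by move=> i /andP[? ?]; apply: uv; lia.
Qed.

Lemma side_Y_zero n w u : (forall i, (i < n)%N -> u i = false) ->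
  side false n w u = false.
Proof.
elim: n => // n IH u0 /=; rewrite (u0 n) // IH; last first.
  by move=> i ik; apply: u0; lia.
by case: (w n).
Qed.

Lemma side_Y_last n w u : (forall i, (i < n)%N -> u i = false) -> u n = true ->
  side false n.+1 w u = true.
Proof.
by move=> u0 un /=; rewrite side_Y_zero // un; case: (w n).
Qed.

Lemma side_Y n j w u v : (j.+2 <= n)%N ->
  (forall i, (i < j)%N -> u i = false) -> u j = true ->
  (forall i, (i < j)%N -> v i = false) -> v j = true ->
  (forall i, (j.+2 <= i < n)%N -> u i = v i) ->
  side false n w u = side false n w v.
Proof.
elim: n => // n IH; rewrite leq_eqVlt => /orP[/eqP [<-]|jn] u0 uj v0 vj uv.
  have H := (side_Y_last w u0 uj); have H' := (side_Y_last w v0 vj).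
  rewrite [LHS]/= [RHS]/= -/(side false j.+1 w u) -/(side false j.+1 w v) H H'.
  by case: (w j.+1) (u j.+1) (v j.+1) => [] [] [].
rewrite /= (uv n); last by lia.
by rewrite IH // => i /andP[? ?]; apply: uv; lia.
Qed.

Definition shift n c (i : nat) : bool := c (n + i)%N.

Lemma lev_shift n c : nonzero c -> (n <= lev c)%N ->
  (n + lev (shift n c))%N = lev c.
Proof.
move=> nc nl; rewrite (@lev_unique _ (lev c - n)%N) ?subnKC //.
  by rewrite /shift subnKC // lev_on.
by move=> i il; rewrite /shift lev_below //; lia.
Qed.

(** In this section A misses the part of the edges with initial word w between the
    heights a and b. *)
Section Cut.
Variables (w : nat -> bool) (n : nat) (a b : R).
Hypotheses (n_gt0 : (0 < n)%N) (a_ge0 : 0 <= a) (ab : a < b) (b_le1 : b <= 1).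

Let mid : R := (a + b) / 2.

Definition half c s : bool :=
  if s <= mid then side true n w c else side false n w c.

(** The level, plus 1, of the Y-vertex at which the half-path through (c, s) ends.
    The path of words of length n ends at a Y-vertex of level n - 1 on the side
    true, and on the side false at a Y-vertex of level at least n, given by the
    first 1 from position n on.  If there is no such 1, the value is n + 1, for
    which the sequence is dead. *)
Definition end_level c s : nat :=
  if half c s then n else (n + lev (shift n c)).+1.

Lemma end_level_ge c s : (n <= end_level c s)%N.
Proof. by rewrite /end_level; case: ifP => // _; nlia. Qed.

(** If the first 1 from n on lies beyond the position M, both visible tails are
    hidden, whatever the exact levels are. *)
Lemma end_level_tail N M c s d s' : (N <= M)%N -> half c s = half d s' ->
  (forall i, (n <= i < M)%N -> c i = d i) ->
  visible_tail (end_level c s) N c = visible_tail (end_level d s') N d.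
Proof.
move=> NM ps cd; rewrite /end_level ps; case: ifP => _.
  by apply: visible_tail_eq => k /andP[? ?]; apply: cd; nlia.
have [[j /andP[nj jM] dj]|none] :=
    pselect (exists2 j, (n <= j < M)%N & d j).
  have nd : nonzero (shift n d) by exists (j - n)%N; rewrite /shift subnKC.
  have lM : (lev (shift n d) <= j - n)%N.
    rewrite leqNgt; apply/negP => /lev_below.
    by rewrite /shift subnKC // dj.
  have -> : lev (shift n c) = lev (shift n d).
    apply: (@lev_agree _ _ (M - n)) => //; first by nlia.
    by move=> i iM; rewrite /shift cd //; nlia.
  by apply: visible_tail_eq => k /andP[? ?]; apply: cd; nlia.
have d0 i : (n <= i < M)%N -> d i = false.
  by move=> h; apply/negbTE/negP => di; apply: none; exists i.
have far c' : (forall i, (n <= i < M)%N -> c' i = false) ->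
    visible_tail (n + lev (shift n c')).+1 N c' = None.
  move=> c0; apply: (@visible_tail_none (n + lev (shift n c')).+1) => //.
  rewrite /psum wsum_eq0 ?ltr0n // => i /andP[? ?]; apply: c0; nlia.
rewrite !far // => i h; by rewrite cd // d0.
Qed.

Lemma end_level_Y_last c s : nonzero c -> mid < s -> n = (lev c).+1 ->
  end_level c s = (lev c).+1.
Proof.
move=> nc ms nE; rewrite /end_level /half leNgt ms /= nE side_Y_last //.
  by move=> i; exact: lev_below.
exact: lev_on.
Qed.

Lemma end_level_Y_high c s : nonzero c -> mid < s -> (n <= lev c)%N ->
  end_level c s = (lev c).+1.
Proof.
move=> nc ms nE; rewrite /end_level /half leNgt ms /= side_Y_zero ?lev_shift //.
by move=> i ik; apply: lev_below; exact: leq_trans nE.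
Qed.

Lemma end_level_Y c s : nonzero c -> mid < s -> (n <= (lev c).+1)%N ->
  end_level c s = (lev c).+1.
Proof.
move=> nc ms; rewrite leq_eqVlt => /orP[/eqP|]; first exact: end_level_Y_last.
by rewrite ltnS; exact: end_level_Y_high.
Qed.

Variable A : set 'rV[R]_3.
Hypotheses (cA : connected A) (AW : A `<=` @wpoints R).
Hypothesis cut : forall c s, agree n c w -> a < s < b -> ~ A (pt c s).

(** Inside an edge the cut keeps the two halves apart.  At the ends of an edge the
    invariance of [side] is used; at a collapsed vertex of level below n - 1 both
    tails are hidden, since dead at a small level implies dead at a larger one. *)
Lemma visible_tail_end_level_locally_constant N :
  locally_constant A (fun c s => visible_tail (end_level c s) N c).
Proof.
have [a0 lab b1] := And3 a_ge0 ab b_le1.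
have [m0 m1] : 0 < mid /\ mid < 1 by rewrite /mid; split; lra.
move=> c0 s0 r0; have [[nz0 b0 /andP[s_ge0 s_le1] D0] A0] := r0.
have [M [NM nM]] : exists M, (N <= M)%N /\ (n <= M)%N.
  by exists (maxn N n); rewrite leq_maxl leq_maxr.
have [sE|sn] := eqVneq s0 1; last have [sE|sn'] := eqVneq s0 0.
- have s0_gt0 : 0 < s0 by rewrite sE.
  have ms0 : mid < s0 by rewrite sE.
  suff [Q [oQ Q0 QP]] : exists Q : set 'rV[R]_3,
    [/\ open Q, Q (pt c0 s0) & forall c s, rep A c s -> Q (pt c s) -> mid < s ->
      visible_tail (end_level c s) N c = visible_tail (end_level c0 s0) N c0].
    exists (Q `&` [set p : 'rV[R]_3 | `|p ord0 coordS - s0| < 1 - mid]); split.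
    + by apply: openI => //; exact: open_height.
    + by split=> //=; rewrite pt_S subrr normr0 subr_gt0.
    move=> c s r [Qc] /=; rewrite pt_S ltr_norml => /andP[h _].
    have ms : mid < s by lra.
    exact: (QP c s r Qc ms).
  have [d0|al] := pselect (dead R (lev c0).+1 c0).
    have [Q [oQ Q0 QP]] := @near_dead R c0 s0 N s0_gt0 d0.
    exists Q; split=> // c s [[nz _ /andP[s0' _] _] _] /(QP _ _ s0')[lc h] ms.
    have [nl|nl] := leqP n (lev c0).+1.
      rewrite !end_level_Y ?lc // (visible_tail_none _ h) //.
      by rewrite (visible_tail_none _ (d0 N)).
    have gc := end_level_ge c s; have g0 := end_level_ge c0 s0.
    rewrite (visible_tail_none _ h); last by nlia.
    by rewrite (visible_tail_none _ (d0 N)) //; nlia.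
  have [Q [oQ Q0 QP]] := @near_alive R c0 s0 M s0_gt0 al.
  exists Q; split=> // c s [[nz _ /andP[s0' _] _] _] /(QP _ _ s0')[lc h] ms.
  have [nl|nl] := leqP n (lev c0).+1.
    rewrite !end_level_Y ?lc //; apply: visible_tail_eq => k /andP[? ?]; apply: h; nlia.
  apply: (@end_level_tail N M) => //.
    rewrite /half !leNgt ms ms0 /=; apply: (@side_Y n (lev c0)) => //.
    + by move=> i il; apply: lev_below; rewrite lc.
    + by rewrite -lc; exact: lev_on.
    + by move=> i; exact: lev_below.
    + exact: lev_on.
    + by move=> i /andP[? ?]; apply: h; nlia.
  by move=> i /andP[? ?]; apply: h; nlia.
- have [|Q [oQ Q0 QP]] := @near_digits R c0 s0 M; first by rewrite sE.
  exists (Q `&` [set p : 'rV[R]_3 | `|p ord0 coordS - s0| < mid]); split.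
  + by apply: openI => //; exact: open_height.
  + by split=> //=; rewrite pt_S subrr normr0.
  move=> c s [[_ _ /andP[_ s1] _] _] [/(QP _ _ s1) h] /=.
  rewrite pt_S sE ltr_norml subr0 => /andP[_ sm].
  apply: (@end_level_tail N M) => //.
    rewrite /half (ltW sm) (ltW m0); apply: side_X => // i /andP[? ?].
    by apply: h; nlia.
  by move=> i /andP[? ?]; apply: h; nlia.
have s0_gt0 : 0 < s0 by rewrite lt_neqAle eq_sym sn'.
have s0_lt1 : s0 < 1 by rewrite lt_neqAle sn.
have [Q [oQ Q0 QP]] := @near_edge R c0 s0 M s0_gt0 s0_lt1 nz0.
exists (Q `&` [set p : 'rV[R]_3 | `|p ord0 coordS - s0| < (b - a) / 2]); split.
- by apply: openI => //; exact: open_height.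
- by split=> //=; rewrite pt_S subrr normr0 divr_gt0 // subr_gt0.
move=> c s [[nz _ s01 _] _] [/(QP _ _ nz s01)[_ h]] /=.
rewrite pt_S ltr_norml => /andP[h1 h2].
apply: (@end_level_tail N M) => //; last by move=> i /andP[? ?]; apply: h; nlia.
have hn : agree n c c0 by move=> i ik; apply: h; nlia.
have [ag|nag] := pselect (agree n c0 w); last first.
  rewrite /half (side_agree true w hn) (side_agree false w hn).
  by rewrite (side_uncut true false nag) !if_same.
have [sa|sb] : s0 <= a \/ b <= s0.
  have [|sa] := leP s0 a; [by left|right].
  rewrite leNgt; apply/negP => sb; apply: (@cut c0 s0 ag) => //.
  by rewrite sa.
- rewrite /half !ifT; first exact: side_agree.
    by rewrite /mid; lra.
  by rewrite /mid; lra.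
- rewrite /half !ifF; first exact: side_agree.
    by apply/negbTE; rewrite -ltNge /mid; lra.
  by apply/negbTE; rewrite -ltNge /mid; lra.
Qed.

Lemma cut_degenerate : degenerate A.
Proof.
have [a0 lab b1] := And3 a_ge0 ab b_le1.
have [|||//|H] := @degenerate_or_dead A n end_level (1 - mid) cA AW.
- by rewrite /mid; lra.
- exact: visible_tail_end_level_locally_constant.
- move=> c s [[nz _ _ _] _]; rewrite subKr => ms nl.
  by rewrite end_level_Y.
apply: (@no_high_Y_degenerate n) => // c r.
by have [_ /(_ erefl)] := H _ _ r; exact: ltnW.
Qed.

End Cut.

(** An open set that meets the space contains, around one of its points, a piece
    of all edges with a common initial word. *)
Lemma nondense_connected_degenerate A (Q : set 'rV[R]_3) :
  connected A -> A `<=` @wpoints R -> open Q ->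
  (exists p, @wpoints R p /\ Q p) -> A `&` Q = set0 -> degenerate A.
Proof.
move=> cA AW oQ [_ [[c0 [s0 [v0 ->]]] Q0]] AQ.
have [nz _ /andP[s_ge0 s_le1] _] := v0.
have [N [e e0 hN]] := pt_continuous nz oQ Q0.
apply: (@cut_degenerate c0 N.+1 (Num.max 0 (s0 - e)) (Num.min 1 (s0 + e))) => //.
- by rewrite le_max lexx.
- rewrite gt_max !lt_min ltr01 /=; apply/and3P; split; lra.
- by rewrite ge_min lexx.
move=> c s ag; rewrite gt_max lt_min => /andP[/andP[? ?] /andP[? ?]] Ac.
suff : (A `&` Q) (pt c s) by rewrite AQ.
split=> //; apply: hN; first by move=> i ik; apply: ag; exact: ltnW.
  by apply/andP; split; exact: ltW.
by rewrite ltr_norml; apply/andP; split; lra.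
Qed.

End Hereditary.

(** * All points are linked in proper closed subsets *)

Section Link.
Variable R : realType.
Implicit Types (c d : nat -> bool) (s : R) (Q : set 'rV[R]_3).

(** Q1 and Q2 split the edges of level below m; in the end they come from a
    separation of the complement of a neighbourhood of z_m. *)
Definition separates (Q1 Q2 : set 'rV[R]_3) (m : nat) : Prop :=
  forall c s, valid c s -> (lev c < m)%N ->
    (Q1 (pt c s) \/ Q2 (pt c s)) /\ ~ (Q1 (pt c s) /\ Q2 (pt c s)).

Lemma separatesC Q1 Q2 m : separates Q1 Q2 m -> separates Q2 Q1 m.
Proof. by move=> h c s v l; have [[?|?] ?] := h c s v l; split; tauto. Qed.

Lemma valid0 c : nonzero c -> wbounded (harm R) c -> valid c (0 : R).
Proof. by move=> nc bc; split; rewrite ?lexx ?ler01 //; apply: Or31. Qed.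

Lemma valid1 c : nonzero c -> wbounded (harm R) c -> valid c (1 : R).
Proof. by move=> nc bc; split; rewrite ?lexx ?ler01 //; apply: Or32. Qed.

(** The following section derives a contradiction from a separation in which
    (c, s0) belongs to Q1 and the Y-end of c to Q2.  The first N digits of c are
    kept; the later digits are chosen greedily, one at a time: the digit 1 is
    accepted if the mass stays below k + s0, or if the resulting point, at height
    mass - k, belongs to Q1 and the mass is at most k + 1.  The mass cannot pass
    k + 1 - delta, where the points are in Q2, so the harmonic series forces
    infinitely many rejections, by arbitrarily small steps.  The limit point
    belongs to Q1 or Q2 and is a limit of accepted points; it is in Q1, hence so
    are the rejected points near it, which is absurd. *)
Section Greedy.
Variables (Q1 Q2 : set 'rV[R]_3) (m : nat) (c : nat -> bool) (s0 : R).
Hypotheses (oQ1 : open Q1) (oQ2 : open Q2) (sep : separates Q1 Q2 m).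
Hypotheses (nc : nonzero c) (lm : (lev c < m)%N).
Variables (N k : nat) (delta : R).
Hypothesis lN : (lev c < N)%N.
Hypothesis aliveN : (lev c).+1%:R <= psum R c (lev c).+2 N.
Hypotheses (s0_ge0 : 0 <= s0) (delta_gt0 : 0 < delta) (delta_le : s0 + delta <= 1).
Hypothesis nearQ1 : forall d s, agree N d c -> 0 <= s <= 1 ->
  `|s - s0| < delta -> Q1 (pt d s).
Hypothesis nearQ2 : forall d s, agree N d c -> 0 <= s <= 1 ->
  `|s - 1| < delta -> Q2 (pt d s).
Hypothesis harmN : forall i, (N <= i)%N -> harm R i < delta.
Hypothesis kN : psum R c 0 N < k%:R.

Let add (d : nat -> bool) (i j : nat) : bool := (j == i) || d j.

Let test (d : nat -> bool) (i : nat) : Prop :=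
  psum R d 0 i.+1 < k%:R + s0 \/
  (psum R d 0 i.+1 <= k%:R + 1 /\ Q1 (pt d (psum R d 0 i.+1 - k%:R))).

Let step (d : nat -> bool) (i : nat) : nat -> bool :=
  if `[< test (add d i) i >] then add d i else d.

Fixpoint greedy (n : nat) : nat -> bool :=
  if n is n'.+1 then step (greedy n') (N + n')
  else fun i => (i < N)%N && c i.

Let S n := psum R (greedy n) 0 (N + n).

Lemma greedy_supp n j : (N + n <= j)%N -> greedy n j = false.
Proof.
elim: n j => [|n IH] j nj /=; first by rewrite ltnNge; move: nj; rewrite addn0 => ->.
rewrite /step; case: asboolP => _; last by apply: IH; lia.
by rewrite /add IH ?orbF; [apply/eqP; lia|lia].
Qed.

Lemma greedy_stable1 n : agree (N + n) (greedy n.+1) (greedy n).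
Proof.
move=> j jn /=; rewrite /step; case: asboolP => // _.
by rewrite /add (_ : (j == _) = false) //; apply/eqP; lia.
Qed.

Lemma greedy_stable n n' : (n <= n')%N -> agree (N + n) (greedy n') (greedy n).
Proof.
move=> /subnK <-; elim: (n' - n)%N => [//|r IH] j jn.
by rewrite addSn (@greedy_stable1 (r + n)%N j) ?IH //; lia.
Qed.

Lemma greedy_agree n : agree N (greedy n) c.
Proof.
move=> j jN; rewrite (greedy_stable (leq0n n)) ?addn0 //=.
by rewrite jN.
Qed.

Let lim (j : nat) : bool := greedy j.+1 j.

Lemma lim_agree n : agree (N + n) lim (greedy n).
Proof.
move=> j jn; rewrite /lim.
rewrite -(greedy_stable (leq_maxl j.+1 n)); last by lia.
by rewrite -(greedy_stable (leq_maxr j.+1 n)).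
Qed.

Lemma lim_agreeN : agree N lim c.
Proof.
move=> j jN; rewrite (@lim_agree 0) ?addn0 //; exact: greedy_agree.
Qed.

Lemma lim_psum n : psum R lim 0 (N + n) = S n.
Proof. by apply: psum_agree (leqnn _) _; exact: lim_agree. Qed.

Lemma add_psum n :
  psum R (add (greedy n) (N + n)) 0 (N + n).+1 = S n + harm R (N + n).
Proof.
rewrite /psum wsum_recr // {2}/add eqxx /=; congr (_ + _).
apply: eq_wsum => i /andP[_ iN]; rewrite /add (_ : (i == _) = false) //.
by apply/eqP; lia.
Qed.

Lemma S_accept n : test (add (greedy n) (N + n)) (N + n) ->
  S n.+1 = S n + harm R (N + n).
Proof.
move=> t; rewrite -add_psum /S addnS /= /step.
by case: asboolP.
Qed.

Lemma S_homo n n' : (n <= n')%N -> S n <= S n'.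
Proof.
move=> nn; rewrite -!lim_psum; apply: wsum_homor; [exact: harm_ge0 | by lia].
Qed.

(** Before the mass reaches k + s0 there is no condition; after that, the current
    point is in Q1. *)
Lemma greedy_inv n : S n < k%:R + s0 \/
  (S n <= k%:R + 1 /\ Q1 (pt (greedy n) (S n - k%:R))).
Proof.
elim: n => [|n IH].
  left; rewrite /S addn0.
  rewrite (@psum_agree _ _ c 0 N N) //; last exact: (@greedy_agree 0).
  by move: kN s0_ge0 => ? ?; lra.
rewrite /S addnS /= /step; case: asboolP => [//|nt].
rewrite /psum wsum_recr // greedy_supp // addr0; exact: IH.
Qed.

Lemma S_le n : S n <= k%:R + 1.
Proof.
move: delta_gt0 delta_le => ? ?.
by case: (greedy_inv n) => [?|[] //]; lra.
Qed.

Lemma not_always_accepted n1 :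
  ~ (forall n, (n1 <= n)%N -> test (add (greedy n) (N + n)) (N + n)).
Proof.
move=> acc.
have SE r : S (n1 + r) = S n1 + \sum_(N + n1 <= i < N + n1 + r) harm R i.
  elim: r => [|r IH]; first by rewrite !addn0 big_geq ?addr0.
  rewrite addnS S_accept; last by apply: acc; lia.
  by rewrite IH addnS big_nat_recr /= ?leq_addr // addrA addnA.
have [M [MN hM]] := harm_diverge (N + n1) (k%:R + 1 - S n1).
have := S_le (n1 + (M - (N + n1))); rewrite SE subnKC //; lra.
Qed.

Lemma agreeN_alive d : agree N d c ->
  [/\ nonzero d, lev d = lev c & ~ dead R (lev d).+1 d].
Proof.
move=> dc; have ld : lev d = lev c by apply: lev_agree dc.
split=> //; first by exists (lev c); rewrite dc // lev_on.
rewrite ld => /(_ N); rewrite (psum_agree R _ (leqnn N) dc).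
by rewrite ltNge aliveN.
Qed.

Lemma greedy_valid n : k%:R <= S n -> valid (greedy n) (S n - k%:R).
Proof.
move=> kS; have [nz _ al] := agreeN_alive (@greedy_agree n).
have [b mE] := wlim_finite (@harm_ge0 R) (@greedy_supp n).
split=> //; first by rewrite subr_ge0 kS /= lerBlDl S_le.
by apply: Or33; split=> //; exists k; rewrite /mass mE addrC subrK.
Qed.

Lemma greedy_sep n : k%:R + s0 <= S n ->
  Q1 (pt (greedy n) (S n - k%:R)) /\ ~ Q2 (pt (greedy n) (S n - k%:R)).
Proof.
move=> kS; have q1 : Q1 (pt (greedy n) (S n - k%:R)).
  by case: (greedy_inv n) => [|[] //]; rewrite ltNge kS.
have v : valid (greedy n) (S n - k%:R).
  by apply: greedy_valid; move: s0_ge0 => ?; lra.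
have [_ ld _] := agreeN_alive (@greedy_agree n).
have [|_ ns] := sep v; first by rewrite ld.
by split=> // q2; apply: ns.
Qed.

Lemma greedy_upper n : k%:R + s0 <= S n -> S n <= k%:R + 1 - delta.
Proof.
move=> kS; rewrite leNgt; apply/negP => h; have [_] := greedy_sep kS.
have := S_le n; have := s0_ge0; move=> s0' Sn.
apply; apply: nearQ2; first exact: greedy_agree.
  by apply/andP; split; lra.
by rewrite ltr_norml; apply/andP; split; move: delta_gt0 => ?; lra.
Qed.

(** The step that first reaches k + s0 overshoots by less than delta, so it is
    accepted. *)
Lemma greedy_reaches : exists n, k%:R + s0 <= S n.
Proof.
apply: contrapT => none.
have lt n : S n < k%:R + s0.
  by rewrite ltNge; apply/negP => h; apply: none; exists n.
apply: (@not_always_accepted 0) => n _; rewrite /test add_psum.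
have [|ge] := ltP (S n + harm R (N + n)) (k%:R + s0); first by left.
right; have hn := harmN (leq_addr n N); have ltn := lt n.
move: delta_gt0 delta_le s0_ge0 => d0 d1 s0'.
split; first by lra.
apply: nearQ1; last by rewrite ltr_norml; apply/andP; split; lra.
  move=> j jN; rewrite /add (_ : (j == _) = false) ?greedy_agree //.
  by apply/eqP; move: jN; clear; lia.
by apply/andP; split; lra.
Qed.

Lemma greedy_absurd : False.
Proof.
have [n0 hn0] := greedy_reaches.
have up n : (n0 <= n)%N -> k%:R + s0 <= S n.
  by move=> nn; apply: le_trans hn0 _; exact: S_homo.
have limS M : psum R lim 0 M <= S (maxn n0 M).
  rewrite -lim_psum; apply: wsum_homor; first exact: harm_ge0.
  by have := leq_maxr n0 M; clear; lia.
have limB M : psum R lim 0 M <= k%:R + 1 - delta.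
  apply: le_trans (limS M) _; apply: greedy_upper; apply: up; exact: leq_maxl.
have bl : wbounded (harm R) lim by exists (k%:R + 1 - delta).
pose sigma := mass R lim.
have sig_le : sigma <= k%:R + 1 - delta by exact: wlim_le.
have S_sig n : S n <= sigma by rewrite -lim_psum; exact: wlim_ub.
have sig_ge : k%:R + s0 <= sigma by apply: le_trans hn0 _.
move: delta_gt0 delta_le s0_ge0 => d0 d1 s0'.
have [nz ll al] := agreeN_alive lim_agreeN.
have s01 : 0 <= sigma - k%:R <= 1 by apply/andP; split; lra.
have v : valid lim (sigma - k%:R).
  by split=> //; apply: Or33; split=> //; exists k; rewrite addrC subrK.
have close (e : R) (M : nat) : 0 < e -> exists n1, [/\ (n0 <= n1)%N, (M <= n1)%N &
    forall n, (n1 <= n)%N -> sigma - e < S n].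
  move=> e0; have [M' hM'] := wlim_adherent bl e0.
  exists (maxn (maxn n0 M') M); split=> [||n hn].
  - by rewrite !leq_max leqnn.
  - by rewrite leq_maxr.
  apply: lt_le_trans hM' _; apply: le_trans (limS M') _.
  by apply: S_homo; apply: leq_trans hn; exact: leq_maxl.
have ll' : (lev lim < m)%N by rewrite ll.
have [[q1|q2] _] := sep v ll'.
- have [M [e e0 near]] := pt_continuous nz oQ1 q1.
  have e2 : 0 < e / 2 by rewrite divr_gt0.
  have [H hH] := harm_small e2.
  have [n1 [n01 Mn1 cl]] := close _ (maxn M H) e2.
  apply: (@not_always_accepted n1) => n nn; right.
  rewrite add_psum.
  have hn := harmN (leq_addr n N).
  have un : S n <= k%:R + 1 - delta.
    by apply: greedy_upper; apply: up; exact: leq_trans nn.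
  have ge := up n (leq_trans n01 nn).
  have h0 := harm_gt0 R (N + n).
  split; first by lra.
  have hHn : harm R (N + n) < e / 2.
    by apply: hH; move: (leq_maxr M H) Mn1 nn; clear; lia.
  have cln := cl n nn; have Sn := S_sig n.
  apply: near.
  + move=> j jM; have jn : (j < N + n)%N.
      by move: (leq_maxl M H) Mn1 nn jM; clear; lia.
    rewrite (lim_agree jn) /add (_ : (j == _) = false) //.
    by apply/eqP; move: jn; clear; lia.
  + by apply/andP; split; lra.
  + by rewrite ltr_norml; apply/andP; split; lra.
- have [M [e e0 near]] := pt_continuous nz oQ2 q2.
  have [n1 [n01 Mn1 cl]] := close _ M e0.
  have [_] := greedy_sep (up n1 n01); apply; apply: near.
  + move=> j jM; rewrite (@lim_agree n1) //.
    by move: jM Mn1; clear; lia.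
  + by have := S_le n1; have := up n1 n01; move=> ? ?; apply/andP; split; lra.
  + have := cl n1 (leqnn _); have := S_sig n1 => ? ?.
    by rewrite ltr_norml; apply/andP; split; lra.
Qed.

End Greedy.

Lemma truncate_finite c N : exists2 d, agree N d c &
  forall i, (N <= i)%N -> d i = false.
Proof.
exists (fun i => (i < N)%N && c i); first by move=> i iN; rewrite iN.
by move=> i; rewrite leqNgt => /negbTE ->.
Qed.

(** No separation splits a living edge, although the edge has at most one interior
    point: the points of nearby edges fill the gaps. *)
Lemma walk Q1 Q2 m c s0 : open Q1 -> open Q2 -> separates Q1 Q2 m ->
  nonzero c -> (lev c < m)%N -> ~ dead R (lev c).+1 c -> 0 <= s0 <= 1 ->
  Q1 (pt c s0) -> ~ Q2 (pt c 1).
Proof.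
move=> oQ1 oQ2 sep nc lm /not_dead[i hi] /andP[s0_ge0 s0_le1] q1 q2.
have [N1 [e1 e1_gt0 near1]] := pt_continuous nc oQ1 q1.
have [N2 [e2 e2_gt0 near2]] := pt_continuous nc oQ2 q2.
have [sE|s1] := eqVneq s0 1.
  have [d dc d0] := truncate_finite c (maxn (lev c).+1 (maxn N1 N2)).
  have lt j : (j < maxn (lev c).+1 (maxn N1 N2))%N -> d j = c j by exact: dc.
  have ld : lev d = lev c by apply: lev_agree dc => //; rewrite leq_max leqnn.
  have nd : nonzero d by exists (lev c); rewrite lt ?leq_max ?leqnn // lev_on.
  have [bd _] := wlim_finite (@harm_ge0 R) d0.
  have [|_] := sep d 1 (valid1 nd bd); first by rewrite ld.
  apply; split; [apply: near1 | apply: near2]; rewrite ?sE ?subrr ?normr0 ?ler01 ?lexx //.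
    by move=> j jN; apply: lt; rewrite !leq_max jN orbT.
  by move=> j jN; apply: lt; rewrite !leq_max jN !orbT.
pose delta := Num.min (Num.min e1 e2) (1 - s0).
have delta_gt0 : 0 < delta by rewrite !lt_min e1_gt0 e2_gt0 subr_gt0 lt_neqAle s1.
have [de1 de2 ds] : [/\ delta <= e1, delta <= e2 & s0 + delta <= 1].
  split; first by rewrite !ge_min lexx.
    by rewrite !ge_min lexx !orbT.
  by rewrite -lerBrDl ge_min lexx orbT.
have [H hH] := harm_small delta_gt0.
pose N := (lev c + N1 + N2 + H + i).+1.
apply: (@greedy_absurd Q1 Q2 m c s0 oQ1 oQ2 sep nc lm N
  (Num.truncn (psum R c 0 N)).+1 delta) => //.
- by rewrite /N; clear; lia.
- apply: le_trans hi (wsum_homor (@harm_ge0 R) _ _ _); rewrite /N; clear; lia.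
- move=> d s dc s01 h; apply: near1 => //; last exact: lt_le_trans de1.
  by move=> j jN; apply: dc; rewrite /N; move: jN; clear; lia.
- move=> d s dc s01 h; apply: near2 => //; last exact: lt_le_trans de2.
  by move=> j jN; apply: dc; rewrite /N; move: jN; clear; lia.
- by move=> j jN; apply: hH; move: jN; rewrite /N; clear; lia.
- exact: truncnS_gt.
Qed.

Lemma alive_ends Q1 Q2 m c : open Q1 -> open Q2 -> separates Q1 Q2 m ->
  nonzero c -> wbounded (harm R) c -> (lev c < m)%N ->
  ~ dead R (lev c).+1 c -> Q1 (pt c 0) <-> Q1 (pt c 1).
Proof.
move=> oQ1 oQ2 sep nc bc lm al.
have i0 : 0 <= (0 : R) <= 1 by rewrite lexx ler01.
split=> q1.
  have [[//|q2] _] := sep _ _ (valid1 nc bc) lm.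
  by have := walk oQ1 oQ2 sep nc lm al i0 q1.
have [[//|q2] _] := sep _ _ (valid0 nc bc) lm.
by have := walk oQ2 oQ1 (separatesC sep) nc lm al i0 q2.
Qed.

Lemma wbounded_tail c d n : (forall i, (n <= i)%N -> c i = d i) ->
  wbounded (harm R) c -> wbounded (harm R) d.
Proof.
move=> cd [B cB]; exists (psum R d 0 n + B) => N.
have B0 : 0 <= B by apply: le_trans (cB 0%N); exact: wsum_ge0 (@harm_ge0 R) _ _ _.
have [Nn|/ltnW nN] := leqP N n.
  by apply: le_trans (wsum_homor (@harm_ge0 R) d 0 Nn) _; rewrite lerDl.
rewrite (@wsum_cat _ _ d 0 n N) // lerD2l.
rewrite -(@eq_wsum _ _ c d); last by move=> i /andP[? _]; apply: cd.
by apply: le_trans (wsum_homol (@harm_ge0 R) c N (leq0n n)) _; exact: cB.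
Qed.

Lemma yseq_tail c d : lev c = lev d ->
  (forall k, ((lev c).+2 <= k)%N -> c k = d k) -> yseq R c = yseq R d.
Proof.
move=> l cd; apply: funext => n; rewrite /yseq.
case: unpickle => // -[i k]; rewrite /ebit /= -l.
have E : psum R c (lev c).+2 i = psum R d (lev c).+2 i.
  by apply: eq_wsum => j /andP[? _]; exact: cd.
case: k => [//|[|k]]; rewrite E //.
by case: (leqP (lev c).+2 k) => [/cd ->|]; rewrite ?andbF.
Qed.

(** The edge at the Y-vertex of level i on the strand of c, with digit b at the
    position that this vertex forgets. *)
Definition turn (i : nat) (b : bool) c (k : nat) : bool :=
  if (k < i)%N then false else if k == i then true
  else if k == i.+1 then b else c k.

Lemma turn_lev i b c : lev (turn i b c) = i.
Proof.
apply: lev_unique; first by rewrite /turn ltnn eqxx.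
by move=> j ji; rewrite /turn ji.
Qed.

Lemma turn_nonzero i b c : nonzero (turn i b c).
Proof. by exists i; rewrite /turn ltnn eqxx. Qed.

Lemma turn_tail i b c k : (i.+2 <= k)%N -> turn i b c k = c k.
Proof.
move=> ik; rewrite /turn ltnNge (ltnW (ltnW ik)) /=.
by rewrite !ifF //; apply/eqP; lia.
Qed.

Lemma turn_next i c k : (i < k)%N -> turn i (c i.+1) c k = c k.
Proof.
move=> ik; have [->|ne] := eqVneq k i.+1; last by rewrite turn_tail //; lia.
by rewrite /turn ltnNge leqnSn /= eqxx ifF //; apply/eqP; lia.
Qed.

Lemma turn_alive i b c M : i.+1%:R <= psum R c i.+2 M ->
  ~ dead R (lev (turn i b c)).+1 (turn i b c).
Proof.
move=> h; rewrite turn_lev => /(_ M); rewrite ltNge.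
rewrite /psum (@eq_wsum _ _ _ c) ?h // => k /andP[? _]; exact: turn_tail.
Qed.

(** Sequences that differ in the digits 0, ..., i only are joined along the Gray
    path: to change digit i + 1, move to the word 0...01 by induction, and cross
    its Y-vertex of level i.  All vertices on the way are alive, as the digits
    beyond i already make the sum large enough. *)
Lemma gray_path Q1 Q2 m i c1 c2 M : open Q1 -> open Q2 -> separates Q1 Q2 m ->
  (i <= m)%N -> wbounded (harm R) c1 -> (forall k, (i < k)%N -> c1 k = c2 k) ->
  i%:R <= psum R c1 i.+1 M -> Q1 (pt c1 0) -> Q1 (pt c2 0).
Proof.
move=> oQ1 oQ2 sep; elim: i c1 c2 => [|i IH] c1 c2 im b1 cc al q1.
  by rewrite (pt_X_eq R (d := c1)) // => k /cc.
have b2 : wbounded (harm R) c2 by apply: (@wbounded_tail c1 c2 i.+2).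
have alE : i.+1%:R <= psum R c2 i.+2 M.
  by rewrite /psum (@eq_wsum _ _ c2 c1) // => k /andP[? _]; rewrite cc.
have lower c : i.+1%:R <= psum R c i.+2 M -> i%:R <= psum R c i.+1 M.
  move=> h; apply: le_trans (wsum_homol (@harm_ge0 R) c M (leqnSn i.+1)).
  by apply: le_trans h; rewrite ler_nat.
have im' := ltnW im.
have be b : wbounded (harm R) (turn i b c1).
  by apply: (@wbounded_tail c1 _ i.+2) => // k /turn_tail ->.
have ge b : Q1 (pt (turn i b c1) 0) <-> Q1 (pt (turn i b c1) 1).
  apply: (alive_ends oQ1 oQ2 sep) => //.
  - exact: turn_nonzero.
  - by rewrite turn_lev.
  - exact: turn_alive al.
have e1 : Q1 (pt (turn i (c1 i.+1) c1) 0).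
  by apply: (IH c1) => //; [move=> k /turn_next -> | exact: lower].
have e2 : Q1 (pt (turn i (c2 i.+1) c1) 0).
  apply/ge; move/ge: e1; rewrite (pt_Y_eq (c := turn i (c2 i.+1) c1)
    (d := turn i (c1 i.+1) c1)) //.
  apply: yseq_tail; rewrite ?turn_lev // => k ik; by rewrite !turn_tail.
apply: (IH (turn i (c2 i.+1) c1)) => //.
- move=> k ik; have [->|ne] := eqVneq k i.+1.
    by rewrite /turn ltnNge leqnSn /= eqxx ifF //; apply/eqP; lia.
  by rewrite turn_tail ?cc //; move: ik ne; clear; lia.
- apply: lower; rewrite /psum (@eq_wsum _ _ _ c1) // => k /andP[? _].
  exact: turn_tail.
Qed.

Lemma yseq_agree_dead z M : dead R (lev z).+1 z -> exists N, forall c,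
  lev c = lev z -> psum R c (lev z).+2 N < (lev z).+1%:R ->
  agree M (yseq R c) (yseq R z).
Proof.
move=> dz; elim: M => [|M [N IH]]; first by exists 0%N.
have [N' hN'] : exists N', forall c, lev c = lev z ->
    psum R c (lev z).+2 N' < (lev z).+1%:R -> yseq R c M = yseq R z M.
  rewrite /yseq; case: unpickle => [[i k]|]; last by exists 0%N.
  exists i => c lc; rewrite /ebit /= lc ltNge => /negbTE h.
  have := dz i; rewrite ltNge => /negbTE h'.
  by case: k => [//|[|k]]; rewrite h h'.
exists (maxn N N') => c lc h j; rewrite ltnS leq_eqVlt => /orP[/eqP ->|jM].
  apply: hN' => //; apply: le_lt_trans h.
  by apply: wsum_homor; [exact: harm_ge0 | exact: leq_maxr].
apply: IH jM => //; apply: le_lt_trans h.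
by apply: wsum_homor; [exact: harm_ge0 | exact: leq_maxl].
Qed.

(** [pt (single j) 1] is the collapsed vertex z_j. *)
Definition single (j i : nat) : bool := i == j.

Lemma single_lev j : lev (single j) = j.
Proof.
apply: lev_unique => [|i ij]; rewrite /single ?eqxx //.
by apply/eqP; lia.
Qed.

Lemma single_nonzero j : nonzero (single j).
Proof. by exists j; rewrite /single eqxx. Qed.

Lemma single_bounded j : wbounded (harm R) (single j).
Proof.
have [] // := @wlim_finite R (harm R) (@harm_ge0 R) (single j) j.+1.
by move=> i ij; apply/eqP; move: ij; clear; lia.
Qed.

Lemma single_dead j n : (0 < n)%N -> (j <= n)%N -> dead R n (single j).
Proof.
move=> n0 jn N; rewrite /psum wsum_eq0 ?ltr0n // => i /andP[ni _].
by apply/eqP; move: ni jn; clear; lia.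
Qed.

(** Take a sequence c' equal to c up to a remote position, followed by so many 1s
    that it is not dead at level j.  The Gray path leads from its X-vertex, which
    is close to that of c, to its Y-vertex of level j, which is close to z_j
    because c is dead at that level. *)
Lemma link_vertex Q1 Q2 m j c : open Q1 -> open Q2 -> separates Q1 Q2 m ->
  (j < m)%N -> nonzero c -> wbounded (harm R) c -> dead R j.+1 c ->
  Q1 (pt c 0) -> Q1 (pt (single j) 1).
Proof.
move=> oQ1 oQ2 sep jm nc bc dc q1.
have jl : (lev (single j) < m)%N by rewrite single_lev.
have [[//|q2] _] := sep _ _ (valid1 (single_nonzero j) (single_bounded j)) jl.
have [N [e e0 near]] := pt_continuous nc oQ1 q1.
have [M nearY] := pt_Y_continuous oQ2 q2.
have dz : dead R (lev (single j)).+1 (single j).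
  by apply: single_dead => //; rewrite single_lev.
have [N' hN'] := yseq_agree_dead M dz; rewrite single_lev in hN'.
pose K := (N + N' + j).+2.
have [L [KL hL]] := harm_diverge K (j.+1%:R : R).
pose c' i := if (i < K)%N then c i else (i < L)%N.
have c'K : agree K c' c by move=> i iK; rewrite /c' iK.
have b' : wbounded (harm R) c'.
  have [] // := @wlim_finite R (harm R) (@harm_ge0 R) c' L.
  by move=> i Li; have := leq_trans KL Li; rewrite /c' !ltnNge Li => ->.
have al : j.+1%:R <= psum R c' j.+2 L.
  apply: le_trans (ltW hL) _.
  apply: le_trans (wsum_homol (@harm_ge0 R) c' L (_ : (j.+2 <= K)%N)); last first.
    by rewrite /K; clear; lia.
  rewrite /wsum le_eqVlt; apply/orP; left; apply/eqP; apply: eq_big_nat.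
  by move=> i /andP[Ki iL]; rewrite /c' ltnNge Ki iL.
have q1' : Q1 (pt c' 0).
  apply: near; rewrite ?lexx ?ler01 ?subrr ?normr0 //.
  by move=> i iN; apply: c'K; rewrite /K; move: iN; clear; lia.
pose d := turn j (c' j.+1) c'.
have bd : wbounded (harm R) d.
  by apply: (@wbounded_tail c' _ j.+2) => // k jk; rewrite /d turn_tail.
have qd : Q1 (pt d 0).
  apply: (@gray_path Q1 Q2 m j.+1 c' d L) => // k jk.
  by rewrite /d turn_next //; exact: ltnW.
have qd1 : Q1 (pt d 1).
  apply/(alive_ends oQ1 oQ2 sep) => //; first exact: turn_nonzero.
    by rewrite turn_lev.
  exact: turn_alive al.
have [|_] := sep _ _ (valid1 (turn_nonzero _ _ _) bd); first by rewrite turn_lev.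
case; split=> //; apply: nearY; apply: hN'; first by rewrite turn_lev.
have -> : psum R d j.+2 N' = psum R c j.+2 N'.
  apply: eq_wsum => i /andP[ji iN]; rewrite /d turn_tail //.
  by apply: c'K; rewrite /K; move: iN; clear; lia.
exact: dc.
Qed.

(** A vertex z_l with l <= m is linked to z_m through the X-vertex of [single 0],
    whose strand is dead at all levels. *)
Lemma link_dead Q1 Q2 m c s : open Q1 -> open Q2 -> separates Q1 Q2 m.+1 ->
  valid c s -> (lev c < m.+1)%N -> dead R m.+1 c -> Q1 (pt c s) ->
  Q1 (pt (single m) 1).
Proof.
move=> oQ1 oQ2 sep v lm dm q1; have [nc bc s01 D] := v.
have X : Q1 (pt c 0) -> Q1 (pt (single m) 1).
  exact: (link_vertex oQ1 oQ2 sep).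
have YX : ~ dead R (lev c).+1 c -> Q1 (pt c 1) -> Q1 (pt c 0).
  by move=> al ?; apply/(alive_ends oQ1 oQ2 sep).
case: D => [s0|s1|[al _]].
- by apply: X; rewrite -s0.
- rewrite s1 in q1; have [dl|al] := pselect (dead R (lev c).+1 c); last first.
    by apply: X; exact: YX.
  have q1l : Q1 (pt (single (lev c)) 1).
    rewrite (pt_Y_eq (d := c)) //; apply: dead_yseq => //; rewrite single_lev //.
    exact: single_dead.
  have nz := single_nonzero 0; have bz := single_bounded 0.
  have base Q Q' : open Q -> open Q' -> separates Q Q' m.+1 ->
      forall j, (j < m.+1)%N -> Q (pt (single 0) 0) -> Q (pt (single j) 1).
    move=> oQ oQ' sepQ j jm.
    by apply: (link_vertex oQ oQ' sepQ) => //; exact: single_dead.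
  have l0 : (lev (single 0) < m.+1)%N by rewrite single_lev.
  have [[q|q] _] := sep _ _ (valid0 nz bz) l0.
    exact: (base Q1 Q2).
  have q2l := base Q2 Q1 oQ2 oQ1 (separatesC sep) _ lm q.
  have [|_] := sep _ _ (valid1 (single_nonzero (lev c)) (single_bounded (lev c))).
    by rewrite single_lev.
  by case.
- apply: X; apply: YX => //.
  have [[//|q2] _] := sep _ _ (valid1 nc bc) lm.
  by have := walk oQ1 oQ2 sep nc lm al s01 q1.
Qed.

Lemma bounded_dead c : wbounded (harm R) c ->
  exists m0, forall m, (m0 <= m)%N -> dead R m c.
Proof.
move=> [B cB]; exists (Num.truncn B).+1 => m mm N.
apply: le_lt_trans (wsum_homol (@harm_ge0 R) c N (leq0n m.+1)) _.
apply: le_lt_trans (cB N) _; apply: lt_le_trans (truncnS_gt B) _.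
by rewrite ler_nat.
Qed.

(** Once m exceeds the levels of p and q, and their strands are dead at level m,
    both points are linked to z_m.  Edges of level m + 1 are not needed, so the
    excluded open set can be taken around z_(m+1). *)
Lemma wpoints_linked p q : @wpoints R p -> @wpoints R q -> exists Q0 : set 'rV[R]_3,
  [/\ open Q0, exists x, @wpoints R x /\ Q0 x, ~ Q0 p, ~ Q0 q &
    forall Q1 Q2 : set 'rV[R]_3, open Q1 -> open Q2 ->
      (forall x, @wpoints R x -> ~ Q0 x -> (Q1 x \/ Q2 x) /\ ~ (Q1 x /\ Q2 x)) ->
      Q1 p -> Q2 q -> False].
Proof.
move=> [c [s [v ->]]] [d [t [v' ->]]].
have [nc bc /andP[s_ge0 _] _] := v; have [nd bd /andP[t_ge0 _] _] := v'.
have [m1 h1] := bounded_dead bc; have [m2 h2] := bounded_dead bd.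
pose m := (lev c + lev d + m1 + m2)%N.
have lc : (lev c < m.+1)%N by rewrite /m; clear; lia.
have ld : (lev d < m.+1)%N by rewrite /m; clear; lia.
have dc : dead R m.+1 c by apply: h1; rewrite /m; clear; lia.
have dd : dead R m.+1 d by apply: h2; rewrite /m; clear; lia.
have [Q0 [oQ0 Q0z Q0P]] := near_lev (single m.+1) 0 (@ltr01 R).
have Q0lev e r : 0 <= r -> (lev e < m.+1)%N -> ~ Q0 (pt e r).
  by move=> r0 le /(Q0P _ _ r0)[]; rewrite single_lev => eE; rewrite eE ltnn in le.
exists Q0; split.
- exact: oQ0.
- exists (pt (single m.+1) 1); split=> //; exists (single m.+1), 1; split=> //.
  by apply: valid1; [exact: single_nonzero | exact: single_bounded].
- exact: Q0lev.
- exact: Q0lev.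
move=> Q1 Q2 oQ1 oQ2 sepW q1 q2.
have sep : separates Q1 Q2 m.+1.
  move=> e r ve le; apply: sepW; first by exists e, r.
  by have [_ _ /andP[r0 _] _] := ve; exact: Q0lev.
have z1 := link_dead oQ1 oQ2 sep v lc dc q1.
have z2 := link_dead oQ2 oQ1 (separatesC sep) v' ld dd q2.
have [|_] := sep _ _ (valid1 (single_nonzero m) (single_bounded m)).
  by rewrite single_lev.
by case.
Qed.

End Link.

(** * Passage to compactifications *)

Section QuasiComponent.
Variables (R : realType) (K : topologicalType).
Hypotheses (cK : compact [set: K]) (hK : hausdorff_space K).

(** The intersection C of the relatively clopen subsets of L that contain p is
    connected: disjoint closed parts of C have disjoint open neighbourhoods U and
    V; by compactness some clopen set of the family is contained in their union,
    and its part in U, or in V, belongs to the family again. *)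
Lemma quasi_component (L : set K) (p q : K) : closed L -> L p -> L q ->
  (forall A B : set K, closed A -> closed B -> A `|` B = L ->
     A `&` B = set0 -> A p -> B q -> False) ->
  exists C : set K, [/\ closed C, connected C, C `<=` L, C p & C q].
Proof.
move=> cL Lp Lq nsep.
pose P := [set A : set K | [/\ closed A, closed (L `\` A), A `<=` L & A p]].
have PL : P L by split=> //; rewrite setDv; exact: closed0.
have PI A B : P A -> P B -> P (A `&` B).
  move=> [cA cA' AL Ap] [cB cB' BL Bp]; split=> //; first exact: closedI.
    by rewrite setDIr; exact: closedU.
  by move=> x [/AL].
have Pq A : P A -> A q.
  move=> [cA cA' AL Ap]; apply: contrapT => nAq.
  by apply: (nsep A (L `\` A)) => //; [exact: setDUK | exact: setDIK].
pose C := \bigcap_(A in P) A.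
have cC : closed C by apply: closed_bigI => A [].
have Cp : C p by move=> A [].
have Cq : C q by move=> A /Pq.
exists C; split=> //; last by move=> x /(_ L PL).
move=> B [b Bb] [D oD BD] [E cE BE].
have cB : closed B by rewrite BE; exact: closedI.
have cB' : closed (C `\` B).
  rewrite (_ : C `\` B = C `&` ~` D).
    by apply: closedI => //; rewrite closedC.
  rewrite BD; apply/seteqP; split=> x [Cx nx]; split=> //.
    by move=> Dx; apply: nx; split.
  by case.
have [U [V [oU oV BU CV UV]]] : exists U V : set K,
    [/\ open U, open V, B `<=` U, C `\` B `<=` V & U `&` V = set0].
  have /(@normal_openP R) := compact_normal hK cK; apply=> //.
  exact: setDIK.
pose Z := ~` (U `|` V).
have cZ : closed Z by rewrite closedC; exact: openU.
have [A PA AUV] : exists2 A, P A & A `<=` U `|` V.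
  apply: contrapT => none.
  have ne A : P A -> A `&` Z !=set0.
    move=> PA; apply: contrapT => /nonemptyPn AZ; apply: none; exists A => // x Ax.
    by apply: contrapT => nx; have : (A `&` Z) x by []; rewrite AZ.
  pose F := filter_from P (fun A => A `&` Z).
  have FF : ProperFilter F.
    apply: filter_from_proper; last by move=> A /ne.
    apply: filter_from_filter; first by exists L.
    by move=> A1 A2 P1 P2; exists (A1 `&` A2); [exact: PI | move=> x [[]]].
  have [x [_]] := cK FF (filterT); rewrite clusterE => cl.
  have Cx : C x.
    move=> A PA; have [cA _ _ _] := PA.
    rewrite (closure_id A).1 //; apply: cl; exists A => //; exact: subIsetl.
  have Zx : Z x.
    by rewrite (closure_id Z).1 //; apply: cl; exists L => //; exact: subIsetr.
  apply: Zx; have [Bx|nBx] := pselect (B x); [left; exact: BU | right; exact: CV].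
have [cA cA' AL Ap] := PA.
have PAI (U' V' : set K) : open U' -> open V' -> A `<=` U' `|` V' ->
    U' `&` V' = set0 -> U' p -> P (A `&` U').
  move=> oU' oV' AUV' UV' U'p; split=> //; last by move=> x [/AL].
    rewrite (_ : _ `&` _ = A `&` ~` V'); first by apply: closedI => //; rewrite closedC.
    apply/seteqP; split=> x [Ax hx]; split=> //.
      by move=> Vx; have : (U' `&` V') x by []; rewrite UV'.
    by case: (AUV' _ Ax).
  rewrite setDIr; apply: closedU => //; rewrite setDE.
  by apply: closedI => //; rewrite closedC.
have [Bp|nBp] := pselect (B p).
  have := PAI U V oU oV AUV UV (BU _ Bp) => PU.
  apply/seteqP; split=> x; first by rewrite BD => -[].
  move=> Cx; apply: contrapT => nBx.
  have [_ Ux] : (A `&` U) x by exact: Cx.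
  suff : (U `&` V) x by rewrite UV.
  by split=> //; exact: CV.
have AVU : A `<=` V `|` U by rewrite setUC.
have VU : V `&` U = set0 by rewrite setIC.
have Vp : V p by apply: CV.
have PV := PAI V U oV oU AVU VU Vp.
have Cb : C b by move: Bb; rewrite BD => -[].
have [_ Vb] : (A `&` V) b by exact: Cb.
suff : (U `&` V) b by rewrite UV.
by split=> //; exact: BU.
Qed.

End QuasiComponent.

Section Main.
Variable R : realType.

Let wspace := set_type (@wpoints R).

Let val_in (x : wspace) : @wpoints R (val x).
Proof. by have := valP x; rewrite inE. Qed.

Let lift p (Wp : @wpoints R p) : wspace := exist _ p (mem_set Wp).

Lemma wspace_linked (x y : wspace) : exists G : set wspace,
  [/\ closed G, G <> [set: wspace], G x, G y &
    forall A B : set wspace, closed A -> closed B -> G `<=` A `|` B ->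
      G `&` (A `&` B) = set0 -> A x -> B y -> False].
Proof.
have [Q0 [oQ0 [z [Wz Q0z]] nx ny sep]] := wpoints_linked (val_in x) (val_in y).
exists (~` (val @^-1` Q0)); split=> //.
- by rewrite closedC; exists Q0.
- by move=> E; have : (~` (val @^-1` Q0) : set wspace) (lift Wz) by rewrite E.
move=> A B cA cB GAB GAB0 Ax By.
have [Q1 oQ1 EB] : open (~` B) by rewrite openC.
have [Q2 oQ2 EA] : open (~` A) by rewrite openC.
have q1 w : Q1 (val w) <-> ~ B w by rewrite -[Q1 (val w)]/((val @^-1` Q1) w) EB.
have q2 w : Q2 (val w) <-> ~ A w by rewrite -[Q2 (val w)]/((val @^-1` Q2) w) EA.
have disj w : ~ Q0 (val w) -> A w -> B w -> False.
  move=> nw Aw Bw.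
  have : ((~` (val @^-1` Q0)) `&` (A `&` B)) w by [].
  by rewrite GAB0.
apply: (sep Q1 Q2) => //; last 2 first.
- by apply/q1 => /(disj _ nx Ax).
- by apply/q2 => Ay; exact: (disj _ ny Ay By).
move=> p Wp nQ0; rewrite -[p]/(val (lift Wp)) in nQ0 *.
case: (GAB (lift Wp) nQ0) => [Aw|Bw]; split.
- by left; apply/q1 => /(disj _ nQ0 Aw).
- by move=> [_ /q2 /(_ Aw)].
- by right; apply/q2 => Aw; exact: (disj _ nQ0 Aw Bw).
- by move=> [/q1 /(_ Bw)].
Qed.

Lemma wspace_connected : connected [set: wspace].
Proof.
move=> B [x Bx] [C oC]; rewrite setTI => BC [D cD].
rewrite setTI => BD; rewrite -BC in oC; rewrite -BD in cD.
apply/seteqP; split=> // y _; apply: contrapT => nBy.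
have [G [cG _ Gx Gy sep]] := wspace_linked x y.
apply: (sep B (~` B)) => //; first by rewrite closedC.
- by move=> z _; exact: lem.
- by rewrite setICr setI0.
Qed.

Lemma wspace_widely_connected : widely_connected wspace.
Proof.
split; first exact: wspace_connected.
move=> C cC [x [y [Cx Cy xy]]] G [z Gz] [Q oQ QG]; apply: contrapT => /nonemptyPn GC.
pose A := (val : wspace -> _) @` C.
have cA : connected A.
  apply: connected_continuous_connected => //.
  exact/continuous_subspaceT/initial_continuous.
apply: xy; apply: val_inj; apply: (@nondense_connected_degenerate R A Q cA) => //.
- by move=> _ [w _ <-].
- by exists (val z); split=> //; move: Gz; rewrite -QG.
- apply/seteqP; split=> // _ [[w Cw <-] Qw].
  suff : (G `&` C) w by rewrite GC.
  by split=> //; rewrite -QG.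
- by exists x.
- by exists y.
Qed.

Lemma wpoints_more_than_one : more_than_one_point (@wpoints R).
Proof.
exists (pt (single 0) 0), (pt (single 0) 1); split.
- exists (single 0), 0; split=> //; apply: valid0.
    exact: single_nonzero.
  exact: single_bounded.
- exists (single 0), 1; split=> //; apply: valid1.
    exact: single_nonzero.
  exact: single_bounded.
move=> /(congr1 (fun p : 'rV[R]_3 => p ord0 coordS)); rewrite !pt_S => /eqP.
by rewrite eq_sym oner_eq0.
Qed.

(** The closure of G in K is proper because e is a homeomorphism onto its image:
    a point of the space outside G stays outside the closure of G. *)
Lemma wspace_reducible (K : topologicalType) (e : wspace -> K) : compactification e ->
  forall p q : wspace, reducible_between (e p) (e q).
Proof.
move=> [cK hK [inj_e cont_e open_e] dense_e] p q; split.
  rewrite (_ : [set: K] = closure (range e)).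
    apply: connected_closure; apply: connected_continuous_connected.
      exact: wspace_connected.
    exact: continuous_subspaceT.
  apply/seteqP; split=> // x _ B; rewrite nbhsE => -[B' [oB' B'x] B'B].
  have [|y [B'y ey]] := dense_e B' _ oB'; first by exists x.
  by exists y; split=> //; exact: B'B.
have [G [cG nG Gp Gq sep]] := wspace_linked p q.
pose L := closure (e @` G).
have Le w : G w -> L (e w) by move=> Gw; apply: subset_closure; exists w.
have [C [cC conC CL Cp Cq]] : exists C : set K,
    [/\ closed C, connected C, C `<=` L, C (e p) & C (e q)].
  apply: (quasi_component R cK hK) => //; [exact: closed_closure|exact: Le|exact: Le|].
  move=> A B cA cB AB AB0 Ap Bq; apply: (sep (e @^-1` A) (e @^-1` B)) => //.
  - by apply: closed_comp => // x _; exact: cont_e.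
  - by apply: closed_comp => // x _; exact: cont_e.
  - by move=> w /Le; rewrite -AB.
  - by apply/seteqP; split=> // w [_ [Aw Bw]]; have : (A `&` B) (e w) by []; rewrite AB0.
exists C; split=> //; last by move=> x [->|->].
split; first by [].
move=> TC; have [w nGw] : exists w, ~ G w.
  apply: contrapT => none; apply: nG; apply/seteqP; split=> // w _.
  by apply: contrapT => nGw; apply: none; exists w.
have oG : open (~` G) by rewrite openC.
have [V oV EV] := open_e _ oG.
have Vw : V (e w).
  have : (V `&` range e) (e w) by rewrite -EV; exists w.
  by case.
have Lw : L (e w) by apply: CL; exact: TC.
have [_ [[g Gg <-] Vg]] := Lw V (open_nbhs_nbhs (conj oV Vw)).
have : (V `&` range e) (e g) by split=> //; exists g.
by rewrite -EV => -[g' nGg' /inj_e E]; apply: nGg'; rewrite E.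
Qed.

End Main.

Theorem mainTheorem9 (R : realType) :
  exists W : set 'rV[R]_3,
    [/\ widely_connected (set_type W),
        more_than_one_point W &
        forall (K : topologicalType) (e : set_type W -> K),
          compactification e ->
          forall p q : set_type W, p <> q -> reducible_between (e p) (e q)].
Proof.
exists (@wpoints R); split.
- exact: wspace_widely_connected.
- exact: wpoints_more_than_one.
- by move=> K e ce p q _; exact: wspace_reducible.
Qed.
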